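(* Let $p(n)\in[0,1]$ satisfy $p(n)=o(1)$ as $n\to\infty$, and for each $n$ let $A\subseteq \mathbb{Z}/n\mathbb{Z}$ be a random subset chosen according to the binomial parameter $p(n)$. Let $S=|A+A|$ and $D=|A-A|$. Then the following hold. (1) (Fast decay) If $p(n)=o(n^{-1/2})$, then (a) $S\sim \frac12 (n\cdot p(n))^2$, and (b) $D\sim (n\cdot p(n))^2$. (2) (Critical decay) If $p(n)=c\,n^{-1/2}$ for a constant $c>0$, then (a) $S\sim n\left(1-\exp(-c^2/2)\right)$, and (b) $D\sim n\left(1-\exp(-c^2)\right)$. (3) (Slow decay) If $\sqrt{\log n}\cdot n^{-1/2}=o(p(n))$ and $n$ is prime (that is, $n\to\infty$ through the primes), then (a) $S\sim n$, and (b) $D\sim n$.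
   Context: Choosing a random subset $A\subseteq\mathbb{Z}/n\mathbb{Z}$ according to a binomial parameter $p(n)$ means that each element of $\mathbb{Z}/n\mathbb{Z}$ is included in $A$ independently with probability $p(n)$. The sumset and difference set are $A+A=\{a+b: a,b\in A\}$ and $A-A=\{a-b: a,b\in A\}$, with addition and subtraction taken in $\mathbb{Z}/n\mathbb{Z}$. For a random variable $X$ depending on $n$ and a function $f(n)$, write $X\sim f(n)$ if for every $\epsilon>0$, $\operatorname{Prob}\left((1-\epsilon)f(n)<X<(1+\epsilon)f(n)\right)\to 1$ as $n\to\infty$. Write $f(n)=o(g(n))$ if $\lim_{n\to\infty} f(n)/g(n)=0$.
   Formalization: In part (1) the extra hypothesis 1/n = o(p(n)), i.e. n·p(n) → ∞, is assumed; without it the claim fails (e.g. p = 0, or whenever n·p(n) stays bounded along a subsequence, since then A is empty with probability bounded away from 0). *)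

(* Defs.v *)
From HB Require Import structures.
From mathcomp Require Import all_boot all_order all_algebra.
From mathcomp Require Import all_classical all_reals all_analysis.
Import Order.TTheory GRing.Theory Num.Theory.
Import numFieldNormedType.Exports.

Set Implicit Arguments.
Unset Strict Implicit.
Unset Printing Implicit Defensive.

Local Open Scope classical_set_scope.
Local Open Scope ring_scope.

Definition sumset (V : finZmodType) (A B : {set V}) : {set V} :=
  [set a + b | a in A, b in B].

Definition diffset (V : finZmodType) (A B : {set V}) : {set V} :=
  [set a - b | a in A, b in B].

Definition mutually_independent d (T : measurableType d) (R : realType)
    (P : probability T R) (I : finType) (E : I -> set T) : Prop :=
  forall J : {set I},
    P (\bigcap_(i in [set` J]) E i) = (\prod_(i in J) P (E i))%E.

Definition binomial_random_subset d (T : measurableType d) (R : realType)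
    (P : probability T R) (V : finType) (q : R) (A : T -> {set V}) : Prop :=
  [/\ forall x : V, measurable [set w | x \in A w],
      forall x : V, P [set w | x \in A w] = q%:E
    & mutually_independent P (fun x : V => [set w | x \in A w])].

(* [F] is [\oo], or its restriction to a set of indices, e.g. the primes.
   The [X n] may live on different probability spaces.  The events are
   measurable when [X n] is a function of a [binomial_random_subset]. *)
Definition asymp_in_prob (R : realType) (d : nat -> measure_display)
    (T : forall n, measurableType (d n)) (P : forall n, probability (T n) R)
    (F : set_system nat) (X : forall n, T n -> R) (f : nat -> R) : Prop :=
  forall eps : R, 0 < eps ->
    P n [set w | (1 - eps) * f n < X n w < (1 + eps) * f n] @[n --> F] --> 1%E.

(* A one-token name: the little-o notation [f =o_F g] does not parse when [F]
   starts with a parenthesis. *)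
Notation prime_oo := (within [set n | prime n] \oo).

(* Main.v *)
Require Import Defs.
From mathcomp Require Import all_boot all_order all_algebra.
From mathcomp Require Import all_classical all_reals all_analysis.
From mathcomp Require Import ring lra zify.
Import Order.TTheory GRing.Theory Num.Theory.
Import numFieldNormedType.Exports.

(** Fast decay: the random set [A] has about [n * p] elements, and two pairs of
    its elements rarely have the same sum or the same difference.  The expected
    number of such collisions is at most about
    [n ^+ 3 * p ^+ 4 = (n * p ^+ 2) * (n * p) ^+ 2] ([expect_collisions]), which is negligible against the number of pairs.
    Hence nearly all unordered pairs give distinct sums and nearly all ordered
    pairs distinct differences ([card_sumset_ge], [card_diffset_ge]).

    Critical and slow decay: count the elements missed by [A + A] or [A - A].  An
    element [x] is missed when [A] contains no edge of the graph joining [a] and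
    [b] whenever they represent [x] (and, for sums, none of the at most two [a]
    with [a + a = x]); for all but a few [x] this graph has about [n / 2] edges
    for sums and [n] edges for differences.  In a graph with [m] edges and bounded degree,
    the events that an edge lies in [A] are nearly independent, so the
    probability of having none is [expR (- m * p ^+ 2)] up to
    [expR (O(n * p ^+ 3))] ([prob_indep_expR_ge], [prob_indep_expR_le]).  This is
    proved by exposing the vertices one at a time ([prob_indep_setU1]).

    Two distinct elements are missed together when [A] has no edge of the union
    of their graphs, whose edge numbers add up except for few degenerate pairs.
    The proportion of missed elements therefore has second moment at most about
    [expR (- 2 * kappa * n * p ^+ 2)] and mean at least about
    [expR (- kappa * n * p ^+ 2)], with [kappa = 1 / 2] for sums and [1] for
    differences, and Chebyshev's inequality applies around the limit of the mean:
    [expR (- kappa * c ^+ 2)] in the critical case, [0] in the slow one. *)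

Set Implicit Arguments.
Unset Strict Implicit.
Unset Printing Implicit Defensive.

Local Open Scope ring_scope.

(** * Expectations over a binomial random subset *)

(** Vertices are exposed one at a time in what follows; this is the induction
    principle for such exposures. *)
Lemma finset_ind (V : finType) (K : {set V} -> Prop) :
  K finset.set0 -> (forall (v : V) (B : {set V}), v \notin B -> K B -> K (v |: B)) ->
  forall B, K B.
Proof.
move=> K0 KU B; move: {2}#|B| (erefl #|B|) => n; elim: n B => [|n IH] B Bn.
  by rewrite (cards0_eq Bn).
have /card_gt0P [v vB] : (0 < #|B|)%N by rewrite Bn.
rewrite -(finset.setD1K vB); apply: KU; first by rewrite !inE eqxx.
by apply: IH; move: Bn; rewrite (cardsD1 v) vB => -[].
Qed.

Section BinomialExpectation.
Variables (R : realFieldType) (V : finType).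
Implicit Types (p : R) (B J : {set V}) (Q : pred {set V}) (f g : {set V} -> R).

Lemma natr_card (C : {set V}) : #|C|%:R = \sum_x (x \in C)%:R :> R.
Proof.
by rewrite -sumr_const big_mkcond; apply: eq_bigr => x _; case: (x \in C).
Qed.

Definition binom_weight p B : R := p ^+ #|B| * (1 - p) ^+ #|~: B|.

Definition expect p f : R := \sum_(B : {set V}) binom_weight p B * f B.

Definition prob p (Q : pred {set V}) : R := expect p (fun B => (Q B)%:R).

Lemma binom_weight_ge0 p B : 0 <= p <= 1 -> 0 <= binom_weight p B.
Proof.
by move=> /andP[p0 p1]; rewrite mulr_ge0 ?exprn_ge0 ?subr_ge0.
Qed.

Lemma expectD p f g :
  expect p (fun B => f B + g B) = expect p f + expect p g.
Proof. by rewrite -big_split; apply: eq_bigr => B _; rewrite mulrDr. Qed.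

Lemma expectZ p a f : expect p (fun B => a * f B) = a * expect p f.
Proof. by rewrite mulr_sumr; apply: eq_bigr => B _; rewrite mulrCA. Qed.

Lemma expectB p f g :
  expect p (fun B => f B - g B) = expect p f - expect p g.
Proof.
by rewrite -[- expect p g]mulN1r -expectZ -expectD;
  apply: eq_bigr => B _; rewrite mulN1r.
Qed.

Lemma expect_sum p (I : finType) (F : I -> {set V} -> R) :
  expect p (fun B => \sum_i F i B) = \sum_i expect p (F i).
Proof.
by rewrite exchange_big; apply: eq_bigr => B _; rewrite mulr_sumr.
Qed.

Lemma expect_le p f g :
  0 <= p <= 1 -> (forall B, f B <= g B) -> expect p f <= expect p g.
Proof.
by move=> p01 fg; apply: ler_sum => B _; rewrite ler_wpM2l ?binom_weight_ge0.
Qed.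

Lemma expect_cst p a : expect p (fun=> a) = a.
Proof.
rewrite /expect -mulr_suml; suff -> : \sum_B binom_weight p B = 1 by rewrite mul1r.
transitivity (\prod_(i : V) (p + (1 - p))); last first.
  by rewrite big1 // => i _; rewrite addrC subrK.
rewrite bigA_distr; apply: eq_bigr => B _.
rewrite (bigID [in B]) /=; congr (_ * _).
  rewrite (eq_bigr (fun=> p)) ?prodr_const // => i; exact: ifT.
rewrite (eq_bigr (fun=> 1 - p)); last by move=> i /negPf ->.
by rewrite prodr_const; congr (_ ^+ _); apply: eq_card => i; rewrite inE.
Qed.

Lemma expect_sqr_dev p f m :
  expect p (fun B => (f B - m) ^+ 2) =
  expect p (fun B => f B ^+ 2) - 2 * m * expect p f + m ^+ 2.
Proof.
rewrite -expectZ -expectB -[X in _ + X](expect_cst p) -expectD.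
by apply: eq_bigr => B _; congr (_ * _); ring.
Qed.

(** The membership of a single [v] can be redrawn independently of the rest:
    pairing each [B] that misses [v] with [v |: B] splits both sides into equal
    terms.  Every later use of independence goes through this identity. *)
Lemma expect_resample p f (v : V) :
  expect p f = expect p (fun B => (1 - p) * f (B :\ v) + p * f (v |: B)).
Proof.
pose split_at F := \sum_(B : {set V} | v \notin B) (F B + F (v |: B) : R).
have splitE F : \sum_(B : {set V}) F B = split_at F.
  rewrite (bigID (fun B : {set V} => v \in B)) /= addrC /split_at big_split.
  congr (_ + _); rewrite (reindex_onto (fun B => v |: B) (fun B => B :\ v)) /=.
    apply: eq_bigl => B; rewrite setU11 /=.
    by apply/eqP/idP => [<-|/finset.setU1K //]; rewrite !inE eqxx.
  by move=> B; exact: finset.setD1K.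
rewrite /expect !splitE; apply: eq_bigr => B vB.
rewrite finset.setU1K // (finset.setUA [set v]) finset.setUid.
have -> : B :\ v = B by apply/finset.setDidPl; rewrite disjoint_sym disjoints1.
have cB : #|~: B| = #|~: (v |: B)|.+1.
  by rewrite finset.setCU finset.setIC -finset.setDE [in LHS](cardsD1 v) inE vB.
rewrite /binom_weight cardsU1 vB cB /= !exprS; ring.
Qed.

Lemma prob_ge0 p Q : 0 <= p <= 1 -> 0 <= prob p Q.
Proof.
by move=> p01; rewrite -[leLHS](expect_cst p); apply: expect_le.
Qed.

Lemma prob_le1 p Q : 0 <= p <= 1 -> prob p Q <= 1.
Proof.
move=> p01; rewrite -[leRHS](expect_cst p); apply: expect_le => // B.
by case: (Q B).
Qed.

Lemma prob_le p Q1 Q2 :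
  0 <= p <= 1 -> (forall B, Q1 B -> Q2 B) -> prob p Q1 <= prob p Q2.
Proof.
move=> p01 Q12; apply: expect_le => // B.
by case: (Q1 B) (Q12 B) => [->|_] //=; case: (Q2 B).
Qed.

Lemma eq_prob p Q1 Q2 : Q1 =1 Q2 -> prob p Q1 = prob p Q2.
Proof. by move=> Q12; apply: eq_bigr => B _; rewrite Q12. Qed.

Lemma prob_resample p (Q : pred {set V}) v :
  prob p Q = (1 - p) * prob p (fun B => Q (B :\ v)) +
             p * prob p (fun B => Q (v |: B)).
Proof. by rewrite /prob (expect_resample _ _ v) expectD !expectZ. Qed.

Lemma prob_subset p J : prob p (fun B => J \subset B) = p ^+ #|J|.
Proof.
elim/finset_ind: J => [|v J vJ IH].
  rewrite cards0 expr0 -[RHS](expect_cst p); apply: eq_bigr => B _.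
  by rewrite finset.sub0set.
rewrite (prob_resample _ _ v) cardsU1 vJ exprS -IH.
have -> : prob p (fun B => v |: J \subset B :\ v) = 0.
  rewrite -[RHS](expect_cst p); apply: eq_bigr => B _.
  by rewrite finset.subUset finset.sub1set !inE eqxx.
rewrite mulr0 add0r; congr (_ * _).
apply: eq_prob => B; rewrite finset.subUset finset.sub1set setU11 /=.
apply/fintype.subsetP/fintype.subsetP => sub x xJ; have := sub x xJ; rewrite !inE.
  by case/orP => // /eqP xv; rewrite xv (negPf vJ) in xJ.
by move=> ->; rewrite orbT.
Qed.

End BinomialExpectation.

(** * Random sets without an edge of a graph *)

Section ElementaryInequalities.
Variable R : realFieldType.
Implicit Types (p x y : R) (d n : nat).

Lemma bernoulli_ge x n : 0 <= x <= 1 -> 1 - n%:R * x <= (1 - x) ^+ n.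
Proof.
move=> /andP[x0 x1]; elim: n => [|n IH]; first by rewrite mul0r subr0.
rewrite exprS; apply: (@le_trans _ _ ((1 - x) * (1 - n%:R * x))).
  have n0 : 0 <= n%:R * x * x :> R by rewrite !mulr_ge0.
  rewrite -natr1; nra.
by rewrite ler_wpM2l ?subr_ge0.
Qed.

Lemma expr_compl_le p d :
  0 <= p <= 1 -> (1 - p) ^+ d <= 1 - d%:R * p + (d%:R * p) ^+ 2.
Proof.
move=> /andP[p0 p1]; elim: d => [|d IH]; first by rewrite mul0r expr0; lra.
rewrite exprS; apply: (@le_trans _ _ ((1 - p) * (1 - d%:R * p + (d%:R * p) ^+ 2))).
  by rewrite ler_wpM2l ?subr_ge0.
have d0 : 0 <= d%:R :> R by [].
have h1 : 0 <= d%:R * p * p by rewrite !mulr_ge0.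
have h2 : 0 <= d%:R * p * (d%:R * p) * p by rewrite !mulr_ge0.
rewrite -natr1; nra.
Qed.

(** The left side is the probability of avoiding [d] disjoint pairs, the right
    side that of avoiding [d] pairs with a common point: sharing points can
    only help. *)
Lemma vertex_factor_ge p d :
  0 <= p <= 1 -> (1 - p ^+ 2) ^+ d <= (1 - p) + p * (1 - p) ^+ d.
Proof.
move=> /andP[p0 p1]; elim: d => [|d IH]; first by rewrite !expr0; lra.
have q0 : 0 <= 1 - p by rewrite subr_ge0.
have pp1 : 0 <= 1 - p ^+ 2 by rewrite subr_ge0 expr_le1.
rewrite exprS; apply: (le_trans (ler_wpM2l pp1 IH)).
rewrite [(1 - p) ^+ d.+1]exprS.
have r1 : (1 - p) ^+ d <= 1 by rewrite exprn_ile1 // lerBlDr lerDl.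
rewrite -subr_ge0.
have -> : 1 - p + p * ((1 - p) * (1 - p) ^+ d) -
  (1 - p ^+ 2) * (1 - p + p * (1 - p) ^+ d) =
  p ^+ 2 * ((1 - p) * (1 - (1 - p) ^+ d)) by ring.
by rewrite !mulr_ge0 ?sqr_ge0 // subr_ge0.
Qed.

(** Numerical core of the upper bound: [I0] and [I1] stand for the
    probabilities of independence inside [U] and inside [U] without the
    neighbours of the exposed vertex.  As [I1] exceeds [I0] by a factor
    [1 + O(p ^+ 2)] only, the exposure costs [1 - d * p ^+ 2 + O(p ^+ 3)]. *)
Lemma vertex_factor_le p d Delta I0 I1 :
  0 <= p <= 1 -> (d <= Delta)%N -> 2 * (Delta%:R * p) ^+ 2 <= 1 ->
  0 <= I0 -> 0 <= I1 -> (1 - p ^+ 2) ^+ (Delta * Delta) * I1 <= I0 ->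
  (1 - p) * I0 + p * ((1 - p) ^+ d * I1) <=
  (1 - d%:R * p ^+ 2 + 4 * Delta%:R ^+ 2 * p ^+ 3) * I0.
Proof.
move=> /[dup] p01 /andP[p0 p1] dD hy I00 I10 hI.
set y := (Delta%:R * p) ^+ 2 in hy.
have y0 : 0 <= y by exact: sqr_ge0.
have q0 : 0 <= 1 - p by rewrite subr_ge0.
have I1le : I1 <= (1 + 2 * y) * I0.
  have : (1 - y) * I1 <= I0.
    apply: le_trans hI; rewrite ler_wpM2r //.
    have -> : y = (Delta * Delta)%:R * p ^+ 2 by rewrite natrM /y; ring.
    by apply: bernoulli_ge; rewrite sqr_ge0 expr_le1.
  move=> yI; have y1 : 0 <= 1 + 2 * y by lra.
  have : 0 <= y * (1 - 2 * y) * I1 by rewrite !mulr_ge0 // subr_ge0.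
  have := ler_wpM2l y1 yI; lra.
have dy : (d%:R * p) ^+ 2 <= y.
  by rewrite ler_sqr ?nnegrE ?mulr_ge0 // ler_wpM2r // ler_nat.
have dp1 : d%:R * p <= 1.
  have := sqr_ge0 (d%:R * p - 1); nra.
have key : (1 - p) ^+ d * I1 <= (1 - d%:R * p + 4 * y) * I0.
  apply: (@le_trans _ _ ((1 - p) ^+ d * ((1 + 2 * y) * I0))).
    by rewrite ler_wpM2l ?exprn_ge0.
  rewrite mulrA ler_wpM2r //.
  apply: (@le_trans _ _ ((1 - d%:R * p + (d%:R * p) ^+ 2) * (1 + 2 * y))).
    by rewrite ler_wpM2r ?expr_compl_le //; lra.
  have : 0 <= d%:R * p * y by rewrite !mulr_ge0.
  nra.
have := ler_wpM2l p0 key.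
have -> : p * ((1 - d%:R * p + 4 * y) * I0) =
  (p - d%:R * p ^+ 2 + 4 * Delta%:R ^+ 2 * p ^+ 3) * I0 by rewrite /y; ring.
lra.
Qed.

End ElementaryInequalities.

Section IndependentSets.
Variables (R : realFieldType) (V : finType) (e : rel V).
Implicit Types (p : R) (U W N B : {set V}).

Definition independent B := [forall a in B, forall b in B, ~~ e a b].

Definition nbrs U v := [set b in U | e v b].

(** Ordered pairs are counted, so for a symmetric and irreflexive [e] this is
    twice the number of edges inside [U]. *)
Definition arcs U : nat := \sum_(a in U) #|nbrs U a|.

Definition prob_indep p U : R := prob p (fun B => independent (B :&: U)).

Lemma independentP B :
  reflect {in B &, forall a b, ~~ e a b} (independent B).
Proof.
apply: (iffP forall_inP) => [h a b aB bB|h a aB].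
  by have /forall_inP := h a aB; apply.
by apply/forall_inP => b bB; apply: h.
Qed.

Lemma independentW B1 B2 : B1 \subset B2 -> independent B2 -> independent B1.
Proof.
move=> /fintype.subsetP sB /independentP h.
by apply/independentP => a b /sB aB /sB bB; apply: h.
Qed.

(** Conditioning on missing [N] just deletes [N] from the random set. *)
Lemma prob_avoid p (Q : pred {set V}) N :
  prob p (fun B => [disjoint N & B] && Q B) =
  (1 - p) ^+ #|N| * prob p (fun B => Q (B :\: N)).
Proof.
elim/finset_ind: N Q => [|v N vN IH] Q.
  rewrite cards0 mul1r; apply: eq_prob => B.
  by rewrite finset.disjoints_subset finset.sub0set finset.setD0.
rewrite (prob_resample _ _ v) cardsU1 vN exprS.
have -> : prob p (fun B => [disjoint v |: N & v |: B] && Q (v |: B)) = 0.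
  rewrite -[RHS](expect_cst V p); apply: eq_bigr => B _.
  by rewrite finset.disjoints_subset finset.subUset finset.sub1set !inE eqxx.
rewrite mulr0 addr0 -mulrA; congr (_ * _).
have -> : prob p (fun B => Q (B :\: (v |: N))) =
          prob p (fun B => Q (B :\: N :\ v)).
  by apply: eq_prob => B; rewrite finset.setUC finset.setDDl.
rewrite -(IH (fun B => Q (B :\ v))); apply: eq_prob => B.
rewrite !finset.disjoints_subset finset.subUset finset.sub1set !inE eqxx /=.
congr (_ && _); apply/fintype.subsetP/fintype.subsetP => sub x xN.
  by have := sub x xN; rewrite !inE negb_and negbK (negPf (memPn vN x xN)).
by rewrite !inE negb_and negbK; have := sub x xN; rewrite inE => ->; rewrite orbT.
Qed.

(** Exposing [v]: if [v] is left out, nothing changes; if it is taken, all its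
    neighbours in [U] must be left out. *)
Lemma prob_indep_setU1 p U v : symmetric e -> irreflexive e -> v \notin U ->
  prob_indep p (v |: U) = (1 - p) * prob_indep p U +
    p * ((1 - p) ^+ #|nbrs U v| * prob_indep p (U :\: nbrs U v)).
Proof.
move=> eS eI vU; rewrite {1}/prob_indep (prob_resample _ _ v).
congr (_ * _ + _ * _).
  apply: eq_prob => B; congr independent; apply/setP => x; rewrite !inE.
  by case: (eqVneq x v) => [->|]; rewrite /= ?(negPf vU) ?andbF.
transitivity (prob p (fun B =>
    [disjoint nbrs U v & B] && independent (B :&: U))); last first.
  rewrite prob_avoid; congr (_ * _); apply: eq_prob => B.
  by congr independent; apply/setP => x; rewrite !inE; case: (x \in U);
    rewrite /= ?andbF ?andbT // andbC.
apply: eq_prob => B; rewrite -finset.setUIr.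
apply/independentP/andP => [h|[dis /independentP h] a b].
  split; last by apply/independentP => a b aB bB; apply: h; exact: finset.setU1r.
  rewrite finset.disjoints_subset; apply/fintype.subsetP => b; rewrite !inE => /andP[bU evb].
  apply/negP => bB; move: evb; apply/negP; apply: h; rewrite !inE ?eqxx //.
  by rewrite bB bU orbT.
have nv b' : b' \in B :&: U -> ~~ e v b'.
  rewrite inE => /andP[bB bU]; apply/negP => evb.
  by have := disjointFl dis bB; rewrite inE bU evb.
rewrite !in_setU1 => /orP[/eqP->|aB] /orP[/eqP->|bB].
- by rewrite eI.
- exact: nv.
- by rewrite eS nv.
- exact: h.
Qed.

Lemma prob_indep_anti p U W :
  0 <= p <= 1 -> U \subset W -> prob_indep p W <= prob_indep p U.
Proof.
move=> p01 UW; apply: prob_le => // B; apply: independentW.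
exact: finset.setIS.
Qed.

Lemma prob_indep_ge0 p U : 0 <= p <= 1 -> 0 <= prob_indep p U.
Proof. exact: prob_ge0. Qed.

Lemma prob_indep_setU1_ge p U v :
  0 <= p <= 1 -> symmetric e -> irreflexive e -> v \notin U ->
  (1 - p ^+ 2) ^+ #|nbrs U v| * prob_indep p U <= prob_indep p (v |: U).
Proof.
move=> /[dup] p01 /andP[p0 p1] eS eI vU; rewrite prob_indep_setU1 //.
apply: (le_trans (ler_wpM2r (prob_indep_ge0 U p01) (vertex_factor_ge _ p01))).
rewrite mulrDl -mulrA lerD2l ler_wpM2l // ler_wpM2l ?exprn_ge0 ?subr_ge0 //.
by apply: prob_indep_anti => //; exact: finset.subsetDl.
Qed.

(** Adding few vertices of bounded degree costs only [1 - O(p ^+ 2)].  This is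
    what replaces correlation inequalities in the upper bound: deleting the
    neighbourhood of a vertex hardly changes the probability. *)
Lemma prob_indep_setU_ge p Delta U N :
  0 <= p <= 1 -> symmetric e -> irreflexive e ->
  (forall v, #|nbrs finset.setT v| <= Delta)%N ->
  (1 - p ^+ 2) ^+ (Delta * #|N|) * prob_indep p U <= prob_indep p (N :|: U).
Proof.
move=> /[dup] p01 /andP[p0 p1] eS eI deg.
have r0 : 0 <= 1 - p ^+ 2 by rewrite subr_ge0 expr_le1.
have r1 : 1 - p ^+ 2 <= 1 by rewrite lerBlDr lerDl sqr_ge0.
have degU W v : (#|nbrs W v| <= Delta)%N.
  apply: leq_trans (deg v); apply/subset_leq_card/fintype.subsetP => x.
  by rewrite !inE => /andP[_ ->].
elim/finset_ind: N => [|v N vN IH].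
  by rewrite cards0 muln0 mul1r finset.set0U.
rewrite cardsU1 vN mulnS exprD -mulrA -finset.setUA.
apply: (le_trans (ler_wpM2l _ IH)); first exact: exprn_ge0.
have [vU|vU] := boolP (v \in N :|: U).
  rewrite finset.setUA [_ |: N]finset.setUC -finset.setUA.
  have -> : N :|: (v |: U) = N :|: U.
    by apply/setP => x; rewrite !inE; case: (eqVneq x v) => // ->;
      move: vU; rewrite inE => ->; rewrite orbT.
  by rewrite ler_piMl ?prob_indep_ge0 // exprn_ile1.
apply: le_trans (prob_indep_setU1_ge p01 eS eI vU).
by rewrite ler_wpM2r ?prob_indep_ge0 // ler_wiXn2l.
Qed.

Lemma prob_indep_setU1_le p Delta U v :
  0 <= p <= 1 -> symmetric e -> irreflexive e ->
  (forall v, #|nbrs finset.setT v| <= Delta)%N ->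
  2 * (Delta%:R * p) ^+ 2 <= 1 -> v \notin U ->
  prob_indep p (v |: U) <=
  (1 - #|nbrs U v|%:R * p ^+ 2 + 4 * Delta%:R ^+ 2 * p ^+ 3) * prob_indep p U.
Proof.
move=> /[dup] p01 /andP[p0 p1] eS eI deg hD vU; rewrite prob_indep_setU1 //.
have r0 : 0 <= 1 - p ^+ 2 by rewrite subr_ge0 expr_le1.
have r1 : 1 - p ^+ 2 <= 1 by rewrite lerBlDr lerDl sqr_ge0.
have degU : (#|nbrs U v| <= Delta)%N.
  apply: leq_trans (deg v); apply/subset_leq_card/fintype.subsetP => x.
  by rewrite !inE => /andP[_ ->].
apply: vertex_factor_le; rewrite ?prob_indep_ge0 //.
have NU : nbrs U v :|: (U :\: nbrs U v) = U.
  by apply/setP => x; rewrite !inE; case: (x \in U); case: (e v x).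
apply: (@le_trans _ _ (prob_indep p (nbrs U v :|: (U :\: nbrs U v)))); last first.
  by rewrite NU.
apply: le_trans (prob_indep_setU_ge _ _ p01 eS eI deg).
by rewrite ler_wpM2r ?prob_indep_ge0 // ler_wiXn2l // leq_mul2l degU orbT.
Qed.

Lemma arcs_setU1 U v : symmetric e -> irreflexive e -> v \notin U ->
  arcs (v |: U) = (arcs U + (#|nbrs U v|).*2)%N.
Proof.
move=> eS eI vU; rewrite /arcs big_setU1 //=.
have -> : nbrs (v |: U) v = nbrs U v.
  by apply/setP => x; rewrite !inE; case: (eqVneq x v) => [->|//];
    rewrite eI !andbF.
have -> : (\sum_(a in U) #|nbrs (v |: U) a| =
           \sum_(a in U) (#|nbrs U a| + e v a))%N.
  apply: eq_bigr => a aU; rewrite addnC (cardsD1 v) !inE eqxx eS /=.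
  congr (_ + _)%N; apply: eq_card => x; rewrite !inE.
  by case: (eqVneq x v) => [->|//]; rewrite (negPf vU).
rewrite big_split /= addnCA -addnn; congr (_ + (_ + _))%N.
rewrite -sum1_card [RHS](eq_bigl (fun a => (a \in U) && e v a)); last first.
  by move=> a; rewrite inE.
by rewrite big_mkcondr; apply: eq_bigr => a _; case: (e v a).
Qed.

End IndependentSets.

Section IndependentSetBounds.
Variables (R : realType) (V : finType) (e : rel V) (p : R).
Hypotheses (eS : symmetric e) (eI : irreflexive e).

Lemma expR_le_1B (x : R) : x < 1 -> expR (- (x / (1 - x))) <= 1 - x.
Proof.
move=> x1; have q0 : 0 < 1 - x by rewrite subr_gt0.
rewrite expRN -[leRHS]invrK lef_pV2 ?posrE ?invr_gt0 ?expR_gt0 //.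
apply: le_trans (expR_ge1Dx _).
by rewrite le_eqVlt; apply/orP; left; apply/eqP; field; lra.
Qed.

(** Multiplying the lower bounds for the successive exposures; the exponent is
    the number of edges times [p ^+ 2], up to a factor tending to [1]. *)
Lemma prob_indep_expR_ge (U : {set V}) : 0 <= p < 1 ->
  expR (- ((arcs e U)%:R / 2 * (p ^+ 2 / (1 - p ^+ 2)))) <= prob_indep e p U.
Proof.
move=> /andP[p0 p1]; have p01 : 0 <= p <= 1 by rewrite p0 ltW.
have q2 : p ^+ 2 < 1 by rewrite expr_lt1.
have q2' : 1 - p ^+ 2 != 0 by rewrite gt_eqF // subr_gt0.
elim/finset_ind: U => [|v U vU IH].
  rewrite /arcs big_set0 !mul0r oppr0 expR0 /prob_indep.
  rewrite -[leLHS](expect_cst V p); apply: expect_le => // B.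
  suff -> : independent e (B :&: finset.set0) by [].
  by apply/independentP => a b; rewrite !inE andbF.
apply: le_trans (prob_indep_setU1_ge p01 eS eI vU).
set d := #|nbrs e U v|; rewrite arcs_setU1 // natrD -/d.
have -> : - (((arcs e U)%:R + d.*2%:R) / 2 * (p ^+ 2 / (1 - p ^+ 2))) =
  d%:R * - (p ^+ 2 / (1 - p ^+ 2))
  + - ((arcs e U)%:R / 2 * (p ^+ 2 / (1 - p ^+ 2))) :> R.
  by rewrite -muln2 natrM; field.
rewrite expRD expRM_natl ler_pM ?exprn_ge0 ?expR_ge0 // lerXn2r ?nnegrE ?expR_ge0 //.
  by rewrite subr_ge0 ltW.
exact: expR_le_1B.
Qed.

(** The matching upper bound.  In bounded degree its error term is smaller by
    a factor [O(p)] than the scale [#|U| * p ^+ 2] of the main term. *)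
Lemma prob_indep_expR_le (U : {set V}) Delta : 0 <= p <= 1 ->
  (forall v, #|nbrs e finset.setT v| <= Delta)%N ->
  2 * (Delta%:R * p) ^+ 2 <= 1 ->
  prob_indep e p U <=
  expR (- ((arcs e U)%:R / 2 * p ^+ 2) + 4 * Delta%:R ^+ 2 * p ^+ 3 * #|U|%:R).
Proof.
move=> p01 deg hD; elim/finset_ind: U => [|v U vU IH].
  rewrite /arcs big_set0 cards0 !mul0r mulr0 oppr0 add0r expR0.
  exact: prob_le1.
apply: (le_trans (prob_indep_setU1_le p01 eS eI deg hD vU)).
set d := #|nbrs e U v|; rewrite arcs_setU1 // natrD -/d cardsU1 vU natrD.
have -> : - (((arcs e U)%:R + d.*2%:R) / 2 * p ^+ 2) +
    4 * Delta%:R ^+ 2 * p ^+ 3 * (1 + #|U|%:R) =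
  (- (d%:R * p ^+ 2) + 4 * Delta%:R ^+ 2 * p ^+ 3) +
  (- ((arcs e U)%:R / 2 * p ^+ 2) + 4 * Delta%:R ^+ 2 * p ^+ 3 * #|U|%:R) :> R.
  by rewrite -muln2 natrM; field.
rewrite expRD; apply: (@le_trans _ _ (expR (- (d%:R * p ^+ 2) +
   4 * Delta%:R ^+ 2 * p ^+ 3) * prob_indep e p U)).
  rewrite ler_wpM2r ?prob_indep_ge0 //; apply: le_trans (expR_ge1Dx _).
  by rewrite addrA.
by rewrite ler_wpM2l ?expR_ge0.
Qed.

End IndependentSetBounds.

(** * Moments of the number of missing elements *)

Section Moments.
Variables (R : realType) (V : finType) (p : R).
Hypothesis p01 : 0 <= p <= 1.

Lemma chebyshev_prob (f : {set V} -> R) m t : 0 < t ->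
  prob p (fun B => t <= `|f B - m|) <= expect p (fun B => (f B - m) ^+ 2) / t ^+ 2.
Proof.
move=> t0; rewrite ler_pdivlMr ?exprn_gt0 // mulrC /prob -expectZ.
apply: expect_le => // B; case: (boolP (t <= _)) => [h|_]; last by rewrite mulr0 sqr_ge0.
by rewrite mulr1 -[leRHS]real_normK ?num_real // lerXn2r ?nnegrE // ltW.
Qed.

Lemma markov_prob (f : {set V} -> R) t : 0 < t -> (forall B, 0 <= f B) ->
  prob p (fun B => t <= f B) <= expect p f / t.
Proof.
move=> t0 f0; rewrite ler_pdivlMr // mulrC /prob -expectZ.
by apply: expect_le => // B; case: (boolP (t <= _)) => [h|_]; rewrite ?mulr1 ?mulr0.
Qed.

(** The second moment of a count is a sum over pairs; the pairs marked [bad]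
    are few and are bounded by [1] each. *)
Lemma expect_sqr_count_le (Z : V -> pred {set V}) (bad : rel V) (K eps : R) :
  \sum_x \sum_y (bad x y)%:R <= K -> 0 <= eps ->
  (forall x y, ~~ bad x y -> prob p (fun B => Z x B && Z y B) <= eps) ->
  expect p (fun B => (\sum_x (Z x B)%:R) ^+ 2) <= K + #|V|%:R ^+ 2 * eps.
Proof.
move=> hK eps0 hZ.
have -> : expect p (fun B => (\sum_x (Z x B)%:R) ^+ 2) =
          \sum_x \sum_y prob p (fun B => Z x B && Z y B).
  transitivity (expect p (fun B => \sum_x \sum_y (Z x B && Z y B)%:R)).
    apply: eq_bigr => B _; congr (_ * _).
    rewrite expr2 mulr_suml; apply: eq_bigr => x _; rewrite mulr_sumr.
    by apply: eq_bigr => y _; rewrite -natrM mulnb.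
  rewrite (expect_sum p (fun x B => \sum_y (Z x B && Z y B)%:R)).
  by apply: eq_bigr => x _; exact: (expect_sum p (fun y B => (Z x B && Z y B)%:R)).
apply: (@le_trans _ _ (\sum_(x : V) \sum_(y : V) ((bad x y)%:R + eps))).
  apply: ler_sum => x _; apply: ler_sum => y _.
  have [b|/hZ h] := boolP (bad x y); last by rewrite add0r.
  by rewrite ler_wpDr // prob_le1.
under eq_bigr do rewrite big_split /= sumr_const.
by rewrite big_split /= sumr_const lerD // -mulrnA -[eps *+ _]mulr_natl natrM expr2.
Qed.

End Moments.

Section MissingElements.
Variable V : finZmodType.
Implicit Types x y a b : V.
Hypothesis halves : forall x, (#|[set a : V | (a + a == x)%R]| <= 2)%N.

(** Neither [x] nor [y] is a sum of two distinct elements of [B] exactly when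
    [B] is independent in this graph.  Loops [a + a] are dropped: they have
    probability [p], not [p ^+ 2], and there are at most two of them per
    target. *)
Definition sum_graph x y : rel V :=
  [rel a b | (a != b) && ((a + b == x) || (a + b == y))].

(** A difference [x] can be realised in both orders, whence [- x]; for generic
    [x] and [y] the graph is therefore regular of degree [4], twice that of
    [sum_graph].  This is the source of the factor [2] between the exponents
    for sums and for differences. *)
Definition diff_graph x y : rel V :=
  [rel a b | (a != b) && (a - b \in [set x; y; - x; - y])].

Lemma sum_graph_sym x y : symmetric (sum_graph x y).
Proof. by move=> a b; rewrite /sum_graph /= eq_sym addrC. Qed.

Lemma sum_graph_irr x y : irreflexive (sum_graph x y).
Proof. by move=> a; rewrite /sum_graph /= eqxx. Qed.

Lemma diff_graph_sym x y : symmetric (diff_graph x y).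
Proof.
move=> a b; rewrite /diff_graph /= [a == b]eq_sym !inE.
have E z : (b - a == z) = (a - b == - z) by rewrite -opprB eqr_oppLR.
rewrite !E !opprK; congr (_ && _).
by case: (_ == x); case: (_ == y); case: (_ == - x); case: (_ == - y).
Qed.

Lemma diff_graph_irr x y : irreflexive (diff_graph x y).
Proof. by move=> a; rewrite /diff_graph /= eqxx. Qed.

Lemma nbrs_sum_graph x y a :
  nbrs (sum_graph x y) finset.setT a = [set x - a; y - a] :\ a.
Proof.
apply/setP => b; rewrite !inE /sum_graph /= [a == b]eq_sym.
have E z : (a + b == z) = (b == z - a).
  by rewrite [b == _]eq_sym subr_eq [a + b]addrC eq_sym.
by rewrite !E.
Qed.

Lemma nbrs_diff_graph x y a :
  nbrs (diff_graph x y) finset.setT a =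
  [set a - t | t in [set x; y; - x; - y]] :\ a.
Proof.
apply/setP => b; rewrite !inE /diff_graph /= [a == b]eq_sym; congr (_ && _).
apply/idP/imsetP => [h|[t ht ->]]; last by rewrite subKr; move: ht; rewrite !inE.
by exists (a - b); rewrite ?subKr // !inE.
Qed.

Lemma card_nbrs_sum_graph x y a :
  (#|nbrs (sum_graph x y) finset.setT a| <= (x != y).+1)%N.
Proof.
rewrite nbrs_sum_graph; apply: (leq_trans (subset_leq_card (finset.subsetDl _ _))).
by rewrite cards2 (inj_eq (addIr _)).
Qed.

Lemma card_nbrs_diff_graph x y a :
  (#|nbrs (diff_graph x y) finset.setT a| <= (x != y).+1.*2)%N.
Proof.
rewrite nbrs_diff_graph; apply: (leq_trans (subset_leq_card (finset.subsetDl _ _))).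
apply: (leq_trans (leq_imset_card _ _)).
have -> : [set x; y; - x; - y] = [set x; y] :|: [set - t | t in [set x; y]].
  by rewrite imsetU1 imset_set1 -!finset.setUA.
apply: (leq_trans (leq_card_setU _ _)); rewrite -addnn.
have -> : (x != y).+1 = #|[set x; y]| by rewrite cards2.
by rewrite leq_add2l leq_imset_card.
Qed.

(** Each vertex has the two neighbours [x - a] and [y - a], except when one of
    them is [a] itself, which happens at most four times. *)
Lemma arcs_sum_graph_ge x y : x != y ->
  (#|V|.*2 <= arcs (sum_graph x y) finset.setT + 4)%N.
Proof.
move=> xy; pose F a : {set V} := [set x - a; y - a].
have -> : #|V|.*2 = (\sum_(a in [set: V]) #|F a|)%N.
  under eq_bigr do rewrite /F cards2 (inj_eq (addIr _)) xy.
  by rewrite sum_nat_const cardsT -muln2.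
rewrite (eq_bigr (fun a => #|nbrs (sum_graph x y) finset.setT a| + (a \in F a)))%N.
  rewrite big_split leq_add2l /=.
  apply: (@leq_trans (#|[set a : V | a + a == x]| + #|[set a : V | a + a == y]|)).
    rewrite -!sum1_card (big_mkcond (mem [set a : V | a + a == x]))
      (big_mkcond (mem [set a : V | a + a == y])) -big_split.
    rewrite big_mkcond; apply: leq_sum => a _.
    rewrite !inE ![a == _ - a]eq_sym !subr_eq ![_ == a + a]eq_sym.
    by do 2!case: (_ == _).
  exact: (leq_add (halves x) (halves y)).
by move=> a _; rewrite nbrs_sum_graph [LHS](cardsD1 a) addnC.
Qed.

Lemma arcs_diff_graph_ge x y :
  ~~ [|| x + x == 0, y + y == 0, y == x | y == - x] ->
  (#|V| * 4 <= arcs (diff_graph x y) finset.setT)%N.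
Proof.
rewrite !negb_or => /and4P[xx yy yx ynx].
have x0 : x != 0 by apply: contra_neq xx => ->; rewrite addr0.
have y0 : y != 0 by apply: contra_neq yy => ->; rewrite addr0.
rewrite -cardsT -sum_nat_const; apply: leq_sum => a _.
rewrite nbrs_diff_graph; set F := imset _ _.
have aF : a \notin F.
  apply/imsetP => -[t]; rewrite !inE => ht /eqP.
  rewrite -subr_eq0 subKr => /eqP t0; move: ht; rewrite t0 ![0 == _]eq_sym.
  by rewrite !oppr_eq0 (negPf x0) (negPf y0).
have -> : F :\ a = F.
  by apply/finset.setDidPl; rewrite disjoint_sym disjoints1.
rewrite card_imset; last by move=> t u /addrI/oppr_inj.
have xnx : x != - x by rewrite -addr_eq0.
have yny : y != - y by rewrite -addr_eq0.
have xny : x != - y by rewrite -eqr_oppLR eq_sym.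
have xy : x != y by rewrite eq_sym.
rewrite -!finset.setUA !cardsU1 !inE cards1 eqr_opp.
by rewrite (negPf xy) (negPf xnx) (negPf yny) (negPf xny) (negPf ynx).
Qed.

Lemma arcs_sum_graph_le x : (arcs (sum_graph x x) finset.setT <= #|V|)%N.
Proof.
rewrite -[leqRHS]muln1 -cardsT -sum_nat_const; apply: leq_sum => a _.
by have := card_nbrs_sum_graph x x a; rewrite eqxx.
Qed.

Lemma arcs_diff_graph_le x : (arcs (diff_graph x x) finset.setT <= #|V|.*2)%N.
Proof.
rewrite -muln2 -cardsT -sum_nat_const; apply: leq_sum => a _.
by have := card_nbrs_diff_graph x x a; rewrite eqxx.
Qed.

End MissingElements.

Section MissingMoments.
Variables (R : realType) (V : finZmodType).
Implicit Types (B : {set V}) (x y a b : V) (p : R).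
Hypothesis halves : forall x, (#|[set a : V | (a + a == x)%R]| <= 2)%N.

Local Notation n := (#|V|%:R : R).

Lemma sumset_missP x B :
  reflect {in B &, forall a b, a + b != x} (x \notin sumset B B).
Proof.
apply: (iffP idP) => [/imset2P h a b aB bB|h].
  by apply/eqP => abx; apply: h; exists a b.
by apply/imset2P => -[a b aB bB xab]; move: (h a b aB bB); rewrite xab eqxx.
Qed.

Lemma diffset_missP x B :
  reflect {in B &, forall a b, a - b != x} (x \notin diffset B B).
Proof.
apply: (iffP idP) => [/imset2P h a b aB bB|h].
  by apply/eqP => abx; apply: h; exists a b.
by apply/imset2P => -[a b aB bB xab]; move: (h a b aB bB); rewrite xab eqxx.
Qed.

Lemma sumr_notin (C : {set V}) : \sum_x (x \notin C)%:R = #|~: C|%:R :> R.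
Proof. by rewrite natr_card; apply: eq_bigr => x _; rewrite inE. Qed.

(** For two distinct targets the graph has about [#|V|] edges and degree at
    most [2], so both are missed with probability at most about the square
    of the probability for one target. *)
Lemma sum_missing_second_moment p : 0 <= p <= 1 -> 32 * p ^+ 2 <= 1 ->
  expect p (fun B => #|~: sumset B B|%:R ^+ 2) <=
  6 * n + n ^+ 2 * expR (- ((n - 2) * p ^+ 2) + 64 * p ^+ 3 * n).
Proof.
move=> /[dup] p01 /andP[p0 p1] hp.
rewrite [leLHS](_ : _ = expect p (fun B => (\sum_x (x \notin sumset B B)%:R) ^+ 2));
  last by apply: eq_bigr => B _; rewrite sumr_notin.
apply: (@expect_sqr_count_le _ _ _ p01 (fun x B => x \notin sumset B B) eq_op).
- rewrite (eq_bigr (fun=> 1)) => [|x _]; last first.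
    by rewrite (bigD1 x) //= eqxx big1 ?addr0 // => y /negPf; rewrite eq_sym => ->.
  by rewrite sumr_const ler_peMl // ler1n.
- exact: expR_ge0.
move=> x y xy; pose e := sum_graph x y.
apply: (@le_trans _ _ (prob_indep e p finset.setT)).
  apply: prob_le => // B /andP[/sumset_missP hx /sumset_missP hy].
  apply/independentP => a b; rewrite !inE !andbT => aB bB.
  by rewrite /e /sum_graph /= (negPf (hx a b aB bB)) (negPf (hy a b aB bB)) andbF.
have deg v : (#|nbrs e finset.setT v| <= 2)%N.
  by have := card_nbrs_sum_graph x y v; rewrite xy.
apply: (le_trans (prob_indep_expR_le (sum_graph_sym x y) (sum_graph_irr x y)
  finset.setT p01 deg _)); first by nra.
rewrite ler_expR cardsT.
have : ((#|V|.*2)%:R <= (arcs e finset.setT + 4)%:R :> R).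
  by rewrite ler_nat; exact: arcs_sum_graph_ge.
rewrite natrD -muln2 natrM => harcs.
have p2 : 0 <= p ^+ 2 by exact: sqr_ge0.
have p3 : 0 <= p ^+ 3 * n by rewrite mulr_ge0 ?exprn_ge0.
nra.
Qed.

(** The factor [(1 - p) ^+ 2] pays for the at most two [a] with [a + a = x],
    which must be left out of the random set. *)
Lemma sum_missing_first_moment p : 0 <= p < 1 ->
  (n - 1) * (1 - p) ^+ 2 * expR (- (2^-1 * n * (p ^+ 2 / (1 - p ^+ 2)))) <=
  expect p (fun B => #|~: sumset B B|%:R).
Proof.
move=> /[dup] p01' /andP[p0 p1]; have p01 : 0 <= p <= 1 by rewrite p0 ltW.
rewrite [leRHS](_ : _ = \sum_x prob p (fun B => x \notin sumset B B)); last first.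
  rewrite -(expect_sum p (fun x B => (x \notin sumset B B)%:R)).
  by apply: eq_bigr => B _; rewrite sumr_notin.
rewrite -mulrA; set c := (1 - p) ^+ 2 * expR _.
have c0 : 0 <= c by rewrite mulr_ge0 ?sqr_ge0 ?expR_ge0.
apply: (@le_trans _ _ (\sum_(x : V) c)).
  rewrite sumr_const -[c *+ _]mulr_natl ler_wpM2r //; lra.
apply: ler_sum => x _; pose e := sum_graph x x; pose L := [set a : V | a + a == x].
have -> : prob p (fun B => x \notin sumset B B) =
  prob p (fun B => [disjoint L & B] && independent e B).
  apply: eq_prob => B; apply/sumset_missP/andP => [h|[hL /independentP he] a b aB bB].
    split; last by apply/independentP => a b aB bB;
      rewrite /e /sum_graph /= (negPf (h a b aB bB)) andbF.
    rewrite finset.disjoints_subset; apply/fintype.subsetP => a; rewrite !inE => aax.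
    by apply/negP => aB; have := h a a aB aB; rewrite aax.
  (* a = b: the diagonal representations are those avoided through L *)
  case: (eqVneq a b) => [ab|ab].
    by have := disjointFl hL aB; rewrite inE -ab => ->.
  by have := he a b aB bB; rewrite /e /sum_graph /= ab orbb.
rewrite prob_avoid /c; apply: ler_pM; rewrite ?sqr_ge0 ?expR_ge0 //.
  by rewrite ler_wiXn2l ?halves // ?subr_ge0 ?gerBl // ltW.
apply: (@le_trans _ _ (prob_indep e p finset.setT)); last first.
  apply: prob_le => // B; apply: independentW; rewrite finset.setIT.
  exact: finset.subsetDl.
apply: le_trans (prob_indep_expR_ge (sum_graph_sym x x) (sum_graph_irr x x) _ p01').
rewrite ler_expR lerN2 ler_wpM2r //.
  by rewrite divr_ge0 ?sqr_ge0 // subr_ge0 expr_le1 // ltW.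
by rewrite mulrC ler_wpM2l ?invr_ge0 // ler_nat arcs_sum_graph_le.
Qed.

(** The pairs to exclude are those where [x] or [y] is its own opposite, or
    where [y] is [x] or [- x]: there the graph has fewer than [2 * #|V|]
    edges. *)
Lemma diff_missing_second_moment p : 0 <= p <= 1 -> 32 * p ^+ 2 <= 1 ->
  expect p (fun B => #|~: diffset B B|%:R ^+ 2) <=
  6 * n + n ^+ 2 * expR (- (2 * (n - 2) * p ^+ 2) + 64 * p ^+ 3 * n).
Proof.
move=> /[dup] p01 /andP[p0 p1] hp.
rewrite [leLHS](_ : _ = expect p (fun B => (\sum_x (x \notin diffset B B)%:R) ^+ 2));
  last by apply: eq_bigr => B _; rewrite sumr_notin.
apply: (@expect_sqr_count_le _ _ _ p01 (fun x B => x \notin diffset B B)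
  (fun x y => [|| x + x == 0, y + y == 0, y == x | y == - x])).
- have h0 : \sum_(x : V) (x + x == 0)%:R <= 2 :> R.
    rewrite -natr_sum ler_nat; apply: leq_trans (halves 0).
    by rewrite -sum1_card big_mkcond [leqRHS]big_mkcond /=; apply: leq_sum => x _;
      rewrite inE; case: (_ == _).
  have h1 (x : V) : \sum_y (y == x)%:R = 1 :> R.
    by rewrite (bigD1 x) //= eqxx big1 ?addr0 // => y /negPf ->.
  apply: (@le_trans _ _ (\sum_(x : V) \sum_(y : V)
     ((x + x == 0)%:R + (y + y == 0)%:R + (y == x)%:R + (y == - x)%:R))).
    apply: ler_sum => x _; apply: ler_sum => y _.
    by do 4!case: (_ == _); rewrite /= ?addr0 ?add0r -?natrD ?ler_nat ?ler0n.
  under eq_bigr do rewrite !big_split /= !h1 sumr_const.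
  rewrite !big_split /= !sumr_const sumrMnl.
  set s := \sum_(x : V) _ in h0 *.
  rewrite -[s *+ _]mulr_natl.
  have := ler_wpM2l (ler0n R #|V|) h0; lra.
- exact: expR_ge0.
move=> x y xy; pose e := diff_graph x y.
apply: (@le_trans _ _ (prob_indep e p finset.setT)).
  apply: prob_le => // B /andP[/diffset_missP hx /diffset_missP hy].
  apply/independentP => a b; rewrite !inE !andbT => aB bB.
  rewrite /e /diff_graph /= !inE -!eqr_oppLR opprB.
  rewrite (negPf (hx a b aB bB)) (negPf (hy a b aB bB)).
  by rewrite (negPf (hx b a bB aB)) (negPf (hy b a bB aB)) andbF.
have deg v : (#|nbrs e finset.setT v| <= 4)%N.
  apply: leq_trans (card_nbrs_diff_graph x y v) _.
  by rewrite -[4%N]/(2.*2) leq_double ltnS leq_b1.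
apply: (le_trans (prob_indep_expR_le (diff_graph_sym x y) (diff_graph_irr x y)
  finset.setT p01 deg _)); first by nra.
rewrite ler_expR cardsT.
have : ((#|V| * 4)%:R <= (arcs e finset.setT)%:R :> R).
  by rewrite ler_nat; exact: arcs_diff_graph_ge.
rewrite natrM => harcs.
have p2 : 0 <= p ^+ 2 by exact: sqr_ge0.
nra.
Qed.

Lemma diff_missing_first_moment p : 0 <= p < 1 ->
  (n - 1) * (1 - p) ^+ 2 * expR (- (n * (p ^+ 2 / (1 - p ^+ 2)))) <=
  expect p (fun B => #|~: diffset B B|%:R).
Proof.
move=> /[dup] p01' /andP[p0 p1]; have p01 : 0 <= p <= 1 by rewrite p0 ltW.
rewrite [leRHS](_ : _ = \sum_x prob p (fun B => x \notin diffset B B)); last first.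
  rewrite -(expect_sum p (fun x B => (x \notin diffset B B)%:R)).
  by apply: eq_bigr => B _; rewrite sumr_notin.
set c := expR _.
have c0 : 0 <= c by exact: expR_ge0.
apply: (@le_trans _ _ (\sum_(x | x != 0 :> V) c)).
  rewrite sumr_const -[c *+ _]mulr_natl ler_wpM2r //.
  have -> : n - 1 = #|[pred x : V | x != 0]|%:R.
    rewrite [#|V|](cardD1 (0 : V)) natrD addrC addKr; congr _%:R.
    by apply: eq_card => x; rewrite !inE andbT.
  by rewrite ler_piMr // ?exprn_ile1 ?subr_ge0 ?gerBl // ltW.
rewrite big_mkcond; apply: ler_sum => x _; case: ifP => x0; last exact: prob_ge0.
pose e := diff_graph x x.
apply: (@le_trans _ _ (prob_indep e p finset.setT)); last first.
  apply: prob_le => // B /independentP h; apply/diffset_missP => a b aB bB.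
  case: (eqVneq a b) => [->|ab]; first by rewrite subrr eq_sym.
  have /= := h a b; rewrite !inE /e /diff_graph /= aB bB ab !inE => /(_ isT isT).
  by rewrite !negb_or => /andP[/andP[/andP[]]].
apply: le_trans (prob_indep_expR_ge (diff_graph_sym x x) (diff_graph_irr x x) _ p01').
rewrite ler_expR lerN2 ler_wpM2r //.
  by rewrite divr_ge0 ?sqr_ge0 // subr_ge0 expr_le1 // ltW.
by rewrite ler_pdivrMr // -natrM ler_nat muln2 arcs_diff_graph_le.
Qed.

End MissingMoments.

(** * Additive collisions *)

Section CollisionCounting.
Variables (R : realType) (V : finZmodType).
Implicit Types (B : {set V}) (x a b c : V).

(** Quadruples [(a, b, c, d)] in [B] with [a + b = c + d] and
    [{a, b} != {c, d}]; the last element is determined by the others.  The same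
    quadruples witness [a - c = d - b], so they also count coincidences among
    differences. *)
Definition collisions B : R :=
  \sum_(a in B) \sum_(b in B) \sum_(c in B)
    [&& a != c, b != c & a + b - c \in B]%:R.

Lemma sum_indicator1 B a : a \in B -> \sum_(c in B) (c == a)%:R = 1 :> R.
Proof.
by move=> aB; rewrite (bigD1 a) //= eqxx big1 ?addr0 // => c /andP[_ /negPf ->].
Qed.

Lemma sum_translate (F : V -> R) B a :
  \sum_x F x * (x - a \in B)%:R = \sum_(b in B) F (a + b).
Proof.
rewrite (reindex_inj (addrI a)) [RHS]big_mkcond; apply: eq_bigr => b _.
by rewrite [a + b]addrC addrK; case: (b \in B); rewrite ?mulr1 ?mulr0.
Qed.

Lemma sum_reflect (F : V -> R) B a :
  \sum_x F x * (a - x \in B)%:R = \sum_(b in B) F (a - b).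
Proof.
rewrite (reindex_inj (inv_inj (subKr a))) [RHS]big_mkcond; apply: eq_bigr => b _.
by rewrite subKr; case: (b \in B); rewrite ?mulr1 ?mulr0.
Qed.

Lemma card_sum B : #|B|%:R = \sum_(a in B) 1 :> R.
Proof. by rewrite sumr_const. Qed.

Definition sum_reps B x : R := \sum_(a in B) (x - a \in B)%:R.
Definition diff_reps B x : R := \sum_(a in B) (a - x \in B)%:R.

Lemma sum_reps_sum B : \sum_x sum_reps B x = #|B|%:R ^+ 2.
Proof.
rewrite exchange_big expr2 {2}card_sum mulr_sumr; apply: eq_bigr => a _.
rewrite mulr1 card_sum -(sum_translate (fun=> 1) B a).
by apply: eq_bigr => x _; rewrite mul1r.
Qed.

Lemma sum_reps_sqr_sum B :
  \sum_x sum_reps B x ^+ 2 <= 2 * #|B|%:R ^+ 2 + collisions B.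
Proof.
have -> : \sum_x sum_reps B x ^+ 2 =
    \sum_(a in B) \sum_(b in B) \sum_(c in B) (a + b - c \in B)%:R.
  under eq_bigr do rewrite expr2 {1}/sum_reps mulr_suml.
  rewrite exchange_big; apply: eq_bigr => a _.
  rewrite -(sum_translate (sum_reps B)).
  by apply: eq_bigr => x _; rewrite mulrC.
have -> : 2 * #|B|%:R ^+ 2 + collisions B = \sum_(a in B) \sum_(b in B)
    \sum_(c in B) ((c == a)%:R + (c == b)%:R +
      [&& a != c, b != c & a + b - c \in B]%:R).
  rewrite /collisions.
  have -> : 2 * #|B|%:R ^+ 2 = \sum_(a in B) \sum_(b in B) (1 + 1) :> R.
    by rewrite !sumr_const -mulrnA -[RHS]mulr_natr natrM expr2.
  rewrite -big_split; apply: eq_bigr => a aB; rewrite -big_split.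
  by apply: eq_bigr => b bB; rewrite !big_split /= !sum_indicator1.
apply: ler_sum => a _; apply: ler_sum => b _; apply: ler_sum => c _.
rewrite [c == a]eq_sym [c == b]eq_sym.
by do 2!case: (_ == _); case: (_ \in B); rewrite /= -?natrD ?ler_nat ?addr0 ?add0r.
Qed.

(** A sum of distinct elements has [r = 2] ordered representations, and
    [4 * r - r ^+ 2] is at most [4], with equality there.  The sum over
    all targets then loses only the collisions and lower-order terms. *)
Lemma card_sumset_ge B :
  #|B|%:R ^+ 2 / 2 - collisions B / 4 <= #|sumset B B|%:R.
Proof.
have h : \sum_x (4 * sum_reps B x - sum_reps B x ^+ 2) <= 4 * #|sumset B B|%:R.
  rewrite natr_card mulr_sumr; apply: ler_sum => x _.
  have [xS|/sumset_missP xS] := boolP (x \in sumset B B).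
    by rewrite mulr1; have := sqr_ge0 (sum_reps B x - 2); nra.
  rewrite /sum_reps big1 ?mulr0 ?expr0n ?subr0 // => a aB.
  case: (boolP (x - a \in B)) => // /(xS a _ aB); by rewrite addrC subrK eqxx.
move: h; rewrite sumrB -mulr_sumr sum_reps_sum.
have := sum_reps_sqr_sum B; lra.
Qed.

(** Off-diagonal sums have two ordered representations; counting the diagonal
    ones twice makes the bound uniform. *)
Lemma card_sumset_le B : #|sumset B B|%:R <= (#|B|%:R ^+ 2 + #|B|%:R) / 2 :> R.
Proof.
rewrite ler_pdivlMr // -sum_reps_sum.
have -> : #|B|%:R = \sum_x \sum_(a in B) (x == a + a)%:R :> R.
  rewrite exchange_big card_sum; apply: eq_bigr => a _.
  by rewrite (bigD1 (a + a)) //= eqxx big1 ?addr0 // => c /negPf ->.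
rewrite -big_split natr_card mulr_suml; apply: ler_sum => x _.
have r0 : 0 <= sum_reps B x by rewrite sumr_ge0.
have d0 : 0 <= \sum_(a in B) (x == a + a)%:R :> R by rewrite sumr_ge0.
have [/imset2P[a b aB bB xab]|_] := boolP (x \in sumset B B); last first.
  by rewrite mul0r addr_ge0.
rewrite mul1r /sum_reps (bigD1 a) //= xab [a + b - a]addrAC subrr add0r bB.
have [ab|ab] := eqVneq a b.
  rewrite lerD ?lerDl ?sumr_ge0 // (bigD1 a) //= ab eqxx lerDl.
  by rewrite sumr_ge0.
rewrite (bigD1 b) /= ?bB ?(eq_sym b) // addrK aB -addrA -[2]/(1 + 1) lerD2l.
by rewrite -addrA lerDl addr_ge0 ?sumr_ge0.
Qed.

Lemma card_diffset_le B : #|diffset B B|%:R <= #|B|%:R ^+ 2 :> R.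
Proof.
have <- : \sum_x diff_reps B x = #|B|%:R ^+ 2.
  rewrite exchange_big expr2 {2}card_sum mulr_sumr; apply: eq_bigr => a _.
  rewrite mulr1 card_sum -(sum_reflect (fun=> 1) B a).
  by apply: eq_bigr => x _; rewrite mul1r.
rewrite natr_card; apply: ler_sum => x _.
have [/imset2P[a b aB bB xab]|_] := boolP (x \in diffset B B); last first.
  by rewrite sumr_ge0.
by rewrite /diff_reps (bigD1 a) //= xab subKr bB lerDl sumr_ge0.
Qed.

Lemma diff_reps_sum B :
  \sum_(x | x != 0) diff_reps B x = #|B|%:R ^+ 2 - #|B|%:R.
Proof.
have -> : #|B|%:R ^+ 2 - #|B|%:R = \sum_(a in B) \sum_(b in B) (b != a)%:R :> R.
  rewrite expr2 {2 3}card_sum mulr_sumr -sumrB; apply: eq_bigr => a aB.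
  rewrite mulr1 -[X in _ - X](sum_indicator1 aB) card_sum -sumrB.
  by apply: eq_bigr => b _; case: (_ == _); rewrite ?subrr ?subr0.
rewrite exchange_big; apply: eq_bigr => a _; rewrite big_mkcond /=.
rewrite [RHS](eq_bigr (fun b => (a - b != 0)%:R : R)); last first.
  by move=> b _; rewrite subr_eq0 eq_sym.
rewrite -(sum_reflect (fun x => (x != 0)%:R : R)); apply: eq_bigr => x _.
by case: (x == 0); rewrite ?mul0r ?mul1r.
Qed.

Lemma diff_reps_sqr_sum B :
  \sum_(x | x != 0) diff_reps B x ^+ 2 <= #|B|%:R ^+ 2 + collisions B.
Proof.
have -> : \sum_(x | x != 0) diff_reps B x ^+ 2 =
    \sum_(a in B) \sum_(b in B) \sum_(c in B) ((b != c) && (a + b - c \in B))%:R.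
  under eq_bigr do rewrite expr2 {1}/diff_reps mulr_suml.
  under [RHS]eq_bigr do rewrite exchange_big /=.
  rewrite exchange_big [RHS]exchange_big /=; apply: eq_bigr => a _.
  transitivity (\sum_(b in B) (a - b != 0)%:R * diff_reps B (a - b)).
    rewrite -(sum_reflect (fun x => (x != 0)%:R * diff_reps B x)) big_mkcond.
    by apply: eq_bigr => x _; case: (x == 0); rewrite ?mul0r ?mul1r // mulrC.
  rewrite [RHS]exchange_big /=; apply: eq_bigr => b _.
  rewrite mulr_sumr; apply: eq_bigr => c _.
  rewrite -natrM mulnb subr_eq0 [b == a]eq_sym.
  by congr (_ && _)%:R; rewrite opprB addrA.
have -> : #|B|%:R ^+ 2 + collisions B = \sum_(a in B) \sum_(b in B)
    \sum_(c in B) ((c == a)%:R + [&& a != c, b != c & a + b - c \in B]%:R).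
  have -> : #|B|%:R ^+ 2 = \sum_(a in B) \sum_(b in B) 1 :> R.
    by rewrite !sumr_const -mulrnA mulnn natrX.
  rewrite -big_split; apply: eq_bigr => a aB; rewrite -big_split.
  by apply: eq_bigr => b bB; rewrite !big_split /= !sum_indicator1.
apply: ler_sum => a _; apply: ler_sum => b _; apply: ler_sum => c _.
rewrite [c == a]eq_sym.
by do 2!case: (_ == _); case: (_ \in B); rewrite /= -?natrD ?ler_nat ?addr0 ?add0r.
Qed.

(** Integrality matters: the quadratic exceeds [2] between [1] and [2]. *)
Lemma natr_quadratic_le2 m : 3 * m%:R - m%:R ^+ 2 <= 2 :> R.
Proof.
case: m => [|[|[|m]]]; rewrite ?mulr0; try lra.
by rewrite -[m.+3]addn3 natrD; have := ler0n R m; nra.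
Qed.

(** A nonzero difference has [r = 1] representation when there is no collision.
    For integers [r] the quadratic [3 * r - r ^+ 2] is at most [2], its value at
    [1]; the zero difference has too many representations and is set aside. *)
Lemma card_diffset_ge B :
  #|B|%:R ^+ 2 - 3 / 2 * #|B|%:R - collisions B / 2 <= #|diffset B B|%:R.
Proof.
have h : \sum_(x | x != 0) (3 * diff_reps B x - diff_reps B x ^+ 2) <=
         2 * #|diffset B B|%:R.
  rewrite natr_card mulr_sumr big_mkcond; apply: ler_sum => x _.
  case: ifP => _; last by rewrite mulr_ge0.
  have [xS|/diffset_missP xS] := boolP (x \in diffset B B).
    by rewrite mulr1 /diff_reps -natr_sum natr_quadratic_le2.
  rewrite /diff_reps big1 ?mulr0 ?expr0n ?subr0 // => a aB.
  by case: (boolP (a - x \in B)) => // /(xS a _ aB); rewrite subKr eqxx.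
move: h; rewrite sumrB -mulr_sumr diff_reps_sum.
have := diff_reps_sqr_sum B; lra.
Qed.

End CollisionCounting.

Section CardinalMoments.
Variables (R : realType) (V : finType) (p : R).
Implicit Types (B : {set V}).
Local Notation n := (#|V|%:R : R).

Lemma expect_card : expect p (fun B => #|B|%:R) = n * p.
Proof.
transitivity (\sum_(x : V) prob p (fun B => [set x] \subset B)).
  rewrite -(expect_sum p (fun x B => ([set x] \subset B)%:R)).
  apply: eq_bigr => B _; congr (_ * _).
  by rewrite natr_card; apply: eq_bigr => x _; rewrite finset.sub1set.
under eq_bigr do rewrite prob_subset cards1 expr1.
by rewrite sumr_const mulr_natl.
Qed.

Lemma expect_card_sqr : expect p (fun B => #|B|%:R ^+ 2) <= (n * p) ^+ 2 + n * p.
Proof.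
rewrite [leLHS](_ : _ =
    \sum_(x : V) \sum_(y : V) prob p (fun B => [set x; y] \subset B)); last first.
  under [RHS]eq_bigr => x _ do
    rewrite -(expect_sum p (fun y B => ([set x; y] \subset B)%:R)).
  rewrite -(expect_sum p (fun x B => \sum_y ([set x; y] \subset B)%:R)).
  apply: eq_bigr => B _; congr (_ * _).
  rewrite expr2 {1}natr_card mulr_suml; apply: eq_bigr => x _.
  rewrite natr_card mulr_sumr; apply: eq_bigr => y _.
  by rewrite finset.subUset !finset.sub1set -natrM mulnb.
apply: (@le_trans _ _ (\sum_(x : V) \sum_(y : V) (p ^+ 2 + (y == x)%:R * p))).
  apply: ler_sum => x _; apply: ler_sum => y _; rewrite prob_subset cards2 eq_sym.
  have [_|_] := eqVneq y x; rewrite /= ?mul1r ?mul0r ?addr0 // expr1.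
  by rewrite lerDr sqr_ge0.
under eq_bigr => x _.
  rewrite big_split /= sumr_const -mulr_suml (bigD1 x) //= eqxx big1; last first.
    by move=> y /negPf ->.
  over.
rewrite big_split /= !sumr_const addr0 mul1r -mulrnA.
by rewrite -[p ^+ 2 *+ _]mulr_natl -[p *+ _]mulr_natl natrM exprMn -expr2.
Qed.

Lemma expect_card_dev : expect p (fun B => (#|B|%:R - n * p) ^+ 2) <= n * p.
Proof.
by rewrite expect_sqr_dev expect_card; have := expect_card_sqr; nra.
Qed.

End CardinalMoments.

Section CollisionMoment.
Variables (R : realType) (V : finZmodType) (p : R).
Hypothesis p01 : 0 <= p <= 1.
Hypothesis halves : forall x, (#|[set a : V | (a + a == x)%R]| <= 2)%N.
Implicit Types (B : {set V}) (a b c d : V).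
Local Notation n := (#|V|%:R : R).

(** In a collision only [a = b] and [c = d] are possible coincidences; the
    second one reads [c + c = a + b]. *)
Lemma collision_prob_le a b c : a != c -> b != c ->
  p ^+ #|[set a; b; c; a + b - c]| <=
  p ^+ 4 + (b == a)%:R * p ^+ 3 + (c + c == a + b)%:R * p ^+ 3 +
  (b == a)%:R * (c + c == a + b)%:R * p ^+ 2.
Proof.
move=> ac bc; have /andP[p0 p1] := p01.
have ad : a != a + b - c by rewrite -addrA -subr_eq0 opprD addrA subrr sub0r oppr_eq0 subr_eq0.
have bd : b != a + b - c.
  by rewrite addrAC -subr_eq0 opprD addrCA subrr addr0 oppr_eq0 subr_eq0.
have cd : (c == a + b - c) = (c + c == a + b) by rewrite eq_sym subr_eq eq_sym.
have p2 : 0 <= p ^+ 2 by exact: sqr_ge0.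
have p3 : 0 <= p ^+ 3 by exact: exprn_ge0.
have p4 : 0 <= p ^+ 4 by exact: exprn_ge0.
rewrite -!finset.setUA !cardsU1 !inE cards1 (negPf ac) (negPf bc) (negPf ad)
  (negPf bd) cd [a == b]eq_sym.
by case: (b == a); case: (c + c == a + b); rewrite /= ?mul1r ?mul0r ?addr0 ?expr1 //; lra.
Qed.

(** Collisions of four distinct elements dominate: there are at most
    [n ^+ 3] of them, and [n ^+ 3 * p ^+ 4] is [o((n * p) ^+ 2)] as soon as
    [n * p ^+ 2] tends to [0]. *)
Lemma expect_collisions :
  expect p (@collisions R V) <=
  n ^+ 3 * p ^+ 4 + 2 * n ^+ 2 * p ^+ 3 + 2 * n * p ^+ 2.
Proof.
have /andP[p0 p1] := p01.
pose f a b c (B : {set V}) : R :=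
  ((a != c) && (b != c))%:R * ([set a; b; c; a + b - c] \subset B)%:R.
have -> : expect p (@collisions R V) = \sum_a \sum_b \sum_c expect p (f a b c).
  transitivity (expect p (fun B => \sum_a \sum_b \sum_c f a b c B)).
    apply: eq_bigr => B _; congr (_ * _).
    rewrite /collisions big_mkcond; apply: eq_bigr => a _.
    have [aB|aB] := boolP (a \in B); last first.
      rewrite big1 // => b _; rewrite big1 // => c _.
      by rewrite /f !finset.subUset !finset.sub1set (negPf aB) mulr0.
    rewrite big_mkcond; apply: eq_bigr => b _.
    have [bB|bB] := boolP (b \in B); last first.
      rewrite big1 // => c _.
      by rewrite /f !finset.subUset !finset.sub1set (negPf bB) andbF mulr0.
    rewrite big_mkcond; apply: eq_bigr => c _.
    rewrite /f !finset.subUset !finset.sub1set aB bB -natrM mulnb andbA.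
    by case: (c \in B); rewrite ?andbF.
  rewrite (expect_sum p (fun a B => \sum_b \sum_c f a b c B)).
  apply: eq_bigr => a _.
  rewrite (expect_sum p (fun b B => \sum_c f a b c B)).
  by apply: eq_bigr => b _; exact: (expect_sum p (f a b)).
pose g a b c : R := p ^+ 4 + (b == a)%:R * p ^+ 3 + (c + c == a + b)%:R * p ^+ 3 +
  (b == a)%:R * (c + c == a + b)%:R * p ^+ 2.
apply: (@le_trans _ _ (\sum_a \sum_b \sum_c g a b c)).
  apply: ler_sum => a _; apply: ler_sum => b _; apply: ler_sum => c _.
  rewrite /f expectZ -/(prob p (fun B => _ \subset B)) prob_subset.
  have [/andP[ac bc]|_] := boolP ((a != c) && (b != c)).
    by rewrite mul1r collision_prob_le.
  by rewrite mul0r !addr_ge0 ?mulr_ge0 ?exprn_ge0.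
have one (x : V) : \sum_y (y == x)%:R = 1 :> R.
  by rewrite (bigD1 x) //= eqxx big1 ?addr0 // => y /negPf ->.
have pick (x : V) (F : V -> R) : \sum_y (y == x)%:R * F y = F x.
  rewrite (bigD1 x) //= eqxx mul1r big1 ?addr0 // => y /negPf ->.
  by rewrite mul0r.
have two (x : V) : \sum_(c : V) (c + c == x)%:R <= 2 :> R.
  rewrite -natr_sum ler_nat; apply: leq_trans (halves x).
  rewrite -sum1_card big_mkcond [leqRHS]big_mkcond /=.
  by apply: leq_sum => c _; rewrite inE; case: (_ == _).
have cst (k : R) : \sum_(x : V) k = n * k by rewrite sumr_const mulr_natl.
have -> : \sum_a \sum_b \sum_c g a b c =
  n ^+ 3 * p ^+ 4 + 2 * n ^+ 2 * p ^+ 3 +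
  (\sum_(a : V) \sum_(c : V) (c + c == a + a)%:R) * p ^+ 2.
  transitivity (\sum_(a : V) (n ^+ 2 * p ^+ 4 + 2 * n * p ^+ 3 +
     (\sum_(c : V) (c + c == a + a)%:R) * p ^+ 2)).
    apply: eq_bigr => a _; rewrite /g.
    under eq_bigr do rewrite !big_split /= !cst -!mulr_suml -mulr_sumr.
    rewrite !big_split /= !cst -mulr_sumr -!mulr_suml one.
    rewrite [\sum_(b : V) \sum_(c : V) (c + c == a + b)%:R]exchange_big /=.
    rewrite [\sum_(c : V) \sum_(b : V) (c + c == a + b)%:R](eq_bigr (fun=> 1)); last first.
      move=> c _; rewrite -[RHS](one (c + c - a)); apply: eq_bigr => b _.
      by rewrite [b == _]eq_sym subr_eq [b + a]addrC.
    by rewrite cst (pick a); ring.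
  by rewrite !big_split /= !cst -mulr_suml; ring.
rewrite lerD2l ler_wpM2r ?sqr_ge0 //.
apply: (@le_trans _ _ (\sum_(a : V) 2)); last by rewrite cst mulrC.
by apply: ler_sum.
Qed.

End CollisionMoment.

(** * Concentration *)

Section Concentration.
Variables (R : realType) (V : finType) (p : R).
Hypothesis p01 : 0 <= p <= 1.
Implicit Types (delta eta : R) (B : {set V}).
Local Notation n := (#|V|%:R : R).

Lemma prob_ge_union (Q Q1 Q2 : pred {set V}) :
  (forall B, ~~ Q1 B -> ~~ Q2 B -> Q B) ->
  1 - prob p Q1 - prob p Q2 <= prob p Q.
Proof.
move=> hQ; rewrite -[X in X - _ - _](expect_cst V p) -!expectB.
apply: expect_le => // B; have := hQ B.
by case: (Q1 B); case: (Q2 B); case: (Q B) => //= h; rewrite ?subrr ?subr0 ?sub0r //;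
  try (by have := h isT isT); lra.
Qed.

(** Chebyshev around the expected limit [mu] of the mean.  Only an upper bound
    on the second moment and a lower bound on the first are used, and for
    [mu = 0] the latter is void. *)
Lemma prob_near_mean (M : {set V} -> R) mu eta t :
  0 < n -> 0 < t -> 0 <= mu <= 1 -> 0 <= eta ->
  expect p (fun B => M B ^+ 2) <= n ^+ 2 * (mu ^+ 2 + eta) ->
  n * (mu - eta) <= expect p M ->
  1 - 3 * eta / t ^+ 2 <= prob p (fun B => `|M B - n * mu| < t * n).
Proof.
move=> n0 t0 /andP[mu0 mu1] eta0 h2 h1; have tn0 : 0 < t * n by rewrite mulr_gt0.
apply: le_trans (@prob_ge_union _ (fun B => t * n <= `|M B - n * mu|) pred0 _); last first.
  by move=> B; rewrite -ltNge.
rewrite [prob p pred0]expect_cst subr0 lerD2l lerN2.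
apply: (le_trans (chebyshev_prob p01 _ _ tn0)).
rewrite ler_pdivrMr ?exprn_gt0 // exprMn mulrA divfK ?expf_neq0 ?gt_eqF //.
rewrite expect_sqr_dev.
have nm0 : 0 <= n * mu by rewrite mulr_ge0.
have := ler_wpM2l nm0 h1.
have : 0 <= n ^+ 2 * (eta * (1 - mu)).
  by rewrite mulr_ge0 ?sqr_ge0 // mulr_ge0 ?subr_ge0 //.
nra.
Qed.

Lemma card_concentration delta eta :
  0 < delta <= 1 -> 1 <= eta * (n * p) ->
  prob p (fun B : {set V} => delta * (n * p) <= `|#|B|%:R - n * p|) <= eta / delta ^+ 2.
Proof.
move=> /andP[d0 d1] hN; have /andP[p0 p1] := p01.
have N0 : 0 < n * p.
  rewrite lt_neqAle mulr_ge0 // andbT; apply: contraTneq hN => <-.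
  by rewrite mulr0 -ltNge.
apply: (le_trans (chebyshev_prob p01 _ _ (mulr_gt0 d0 N0))).
apply: (le_trans (ler_wpM2r _ (expect_card_dev V p))).
  by rewrite invr_ge0 sqr_ge0.
rewrite ler_pdivrMr ?(exprn_gt0 _ (mulr_gt0 d0 N0)) // exprMn mulrA divfK; last first.
  by rewrite expf_neq0 // gt_eqF.
by rewrite expr2 mulrA ler_peMl // ltW.
Qed.

End Concentration.

Section FastRegime.
Variables (R : realType) (V : finZmodType) (p : R).
Hypothesis p01 : 0 <= p <= 1.
Hypothesis halves : forall x, (#|[set a : V | (a + a == x)%R]| <= 2)%N.
Implicit Types (delta eta : R) (B : {set V}).
Local Notation n := (#|V|%:R : R).

Lemma collisions_concentration delta eta :
  0 < delta <= 1 -> 1 <= eta * (n * p) -> n * p ^+ 2 <= eta -> p <= eta ->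
  prob p (fun B : {set V} => delta * (n * p) ^+ 2 <= collisions R B) <= 5 * eta / delta.
Proof.
move=> /andP[d0 d1] hN hnp hp; have /andP[p0 p1] := p01.
have N0 : 0 < n * p.
  rewrite lt_neqAle mulr_ge0 // andbT; apply: contraTneq hN => <-.
  by rewrite mulr0 -ltNge.
have c0 B : 0 <= collisions R B :> R by do 3!apply: sumr_ge0 => ? _.
apply: (le_trans (markov_prob p01 (mulr_gt0 d0 (exprn_gt0 2 N0)) c0)).
apply: (le_trans (ler_wpM2r _ (expect_collisions p01 halves))).
  by rewrite invr_ge0 mulr_ge0 ?sqr_ge0 ?ltW.
have dN := mulr_gt0 d0 (exprn_gt0 2 N0).
rewrite ler_pdivrMr // [_ / delta * _]mulrA divfK ?gt_eqF //.
have h1 := ler_wpM2r (sqr_ge0 (n * p)) hnp.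
have h2 := ler_wpM2r (sqr_ge0 (n * p)) hp.
have h3 : n * p ^+ 2 <= eta * (n * p) ^+ 2.
  rewrite expr2 mulrA; apply: (@le_trans _ _ (n * p)).
    by rewrite ler_piMr // ltW.
  have := ler_wpM2r (ltW N0) hN; rewrite mul1r; lra.
rewrite [leLHS](_ : _ = n * p ^+ 2 * (n * p) ^+ 2 + 2 * (p * (n * p) ^+ 2) +
  2 * (n * p ^+ 2)); last by ring.
lra.
Qed.

(** If [X] is within a factor [1 + delta] of [N] then [X ^+ 2] is within
    [1 + O(delta)] of [N ^+ 2], and [X] itself is a lower-order term once
    [N] is large. *)
Lemma square_window (N X delta : R) : 0 < delta <= 1 -> 1 <= delta * N ->
  `|X - N| < delta * N ->
  [/\ 0 <= X, X <= 2 * delta * N ^+ 2, (1 - 2 * delta) * N ^+ 2 <= X ^+ 2,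
      X ^+ 2 <= (1 + 3 * delta) * N ^+ 2 & 0 < delta * N ^+ 2].
Proof.
move=> /andP[d0 d1] hN; rewrite ltr_norml => /andP[X1 X2].
have N0 : 0 < N by rewrite -(pmulr_rgt0 _ d0); lra.
have dN2 : N <= delta * N ^+ 2 by rewrite expr2 mulrA ler_peMl // ltW.
have X0 : 0 <= X by have := ler_wpM2r (ltW N0) d1; lra.
have dN : 0 <= N ^+ 2 * delta * (1 - delta).
  by rewrite !mulr_ge0 ?sqr_ge0 ?subr_ge0 // ltW.
have lo : ((1 - delta) * N) ^+ 2 <= X ^+ 2.
  by rewrite lerXn2r ?nnegrE ?mulr_ge0 ?subr_ge0 // ?ltW //; lra.
have hi : X ^+ 2 <= ((1 + delta) * N) ^+ 2.
  by rewrite lerXn2r ?nnegrE ?mulr_ge0 // ?addr_ge0 // ?ltW //; lra.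
have d2 : 0 <= N ^+ 2 * delta ^+ 2 by rewrite mulr_ge0 ?sqr_ge0.
split => //.
- have := ler_wpM2r (ltW N0) d1; lra.
- by move: lo; rewrite exprMn; nra.
- by move: hi; rewrite exprMn; nra.
- lra.
Qed.

Lemma card_sumset_window delta B :
  0 < delta <= 1 -> 1 <= delta * (n * p) ->
  `|#|B|%:R - n * p| < delta * (n * p) ->
  collisions R B < delta * (n * p) ^+ 2 ->
  (1 - 6 * delta) * (2^-1 * (n * p) ^+ 2) < #|sumset B B|%:R <
  (1 + 6 * delta) * (2^-1 * (n * p) ^+ 2).
Proof.
move=> d01 hN /(square_window d01 hN)[X0 X1 X2 X3 dN2] hQ.
have := card_sumset_ge R B; have := card_sumset_le R B => hi lo.
by apply/andP; split; lra.
Qed.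

Lemma card_diffset_window delta B :
  0 < delta <= 1 -> 1 <= delta * (n * p) ->
  `|#|B|%:R - n * p| < delta * (n * p) ->
  collisions R B < delta * (n * p) ^+ 2 ->
  (1 - 6 * delta) * (n * p) ^+ 2 < #|diffset B B|%:R <
  (1 + 6 * delta) * (n * p) ^+ 2.
Proof.
move=> d01 hN /(square_window d01 hN)[X0 X1 X2 X3 dN2] hQ.
have := card_diffset_ge R B; have := card_diffset_le R B => hi lo.
by apply/andP; split; lra.
Qed.

Lemma fast_concentration delta eta (f : {set V} -> nat) m :
  0 < delta <= 1 -> 0 < eta ->
  1 <= eta * (n * p) -> n * p ^+ 2 <= eta -> p <= eta ->
  (forall B, `|#|B|%:R - n * p| < delta * (n * p) ->
     collisions R B < delta * (n * p) ^+ 2 ->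
     (1 - 6 * delta) * m < (f B)%:R < (1 + 6 * delta) * m) ->
  1 - 6 * eta / delta ^+ 2 <=
    prob p (fun B => (1 - 6 * delta) * m < (f B)%:R < (1 + 6 * delta) * m).
Proof.
move=> /[dup] d01 /andP[d0 d1] e0 hN hnp hp hf.
apply: le_trans (prob_ge_union p01
  (Q1 := fun B : {set V} => delta * (n * p) <= `|#|B|%:R - n * p|)
  (Q2 := fun B => delta * (n * p) ^+ 2 <= collisions R B) _); last first.
  by move=> B; rewrite -!ltNge; exact: hf.
have h1 := card_concentration p01 d01 hN.
have h2 := collisions_concentration d01 hN hnp hp.
have h3 : 5 * eta / delta <= 5 * eta / delta ^+ 2.
  rewrite ler_wpM2l ?mulr_ge0 ?(ltW e0) // lef_pV2 ?posrE ?exprn_gt0 //.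
  by rewrite expr2 ler_piMl // ltW.
rewrite -addrA -opprD lerD2l lerN2.
have -> : 6 * eta / delta ^+ 2 = eta / delta ^+ 2 + 5 * eta / delta ^+ 2 by ring.
lra.
Qed.

End FastRegime.

(** * The law of a binomial random subset *)

Local Open Scope classical_set_scope.
Local Open Scope ring_scope.

Section Law.
Variables (d : measure_display) (T : measurableType d) (R : realType).
Variables (P : probability T R) (V : finType) (q : R) (A : T -> {set V}).
Hypothesis hA : binomial_random_subset P q A.

Lemma measurable_atom (B : {set V}) : measurable [set w | A w = B].
Proof.
have [mA _ _] := hA.
rewrite [X in measurable X](_ : _ = \bigcap_(x in [set: V])
  (if x \in B then [set w | x \in A w] else ~` [set w | x \in A w])).
  apply: fin_bigcap_measurable => // x _; case: ifP => _; first exact: mA.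
  exact: measurableC (mA x).
apply/seteqP; split => w /=; first by move=> AB x _; case: ifP => xB /=; rewrite AB xB.
move=> h; apply/setP => x; have := h x I.
by case: (x \in B) => /= [->//|/negP/negPf].
Qed.

Lemma probability_preimage (Q : pred {set V}) :
  P [set w | Q (A w)] = (\sum_(B | Q B) fine (P [set w | A w = B]))%:E.
Proof.
pose r := [seq B <- index_enum {set V} | Q B].
rewrite [X in P X](_ : _ = \bigcup_(B in [set` r]) [set w | A w = B]); last first.
  apply/seteqP; split => w /= => [QA|[B /=]].
    by exists (A w) => //=; rewrite mem_filter QA mem_index_enum.
  by rewrite mem_filter => /andP[QB _] ->.
rewrite measure_fin_bigcup //=; last 2 first.
- by move=> B1 B2 _ _ [w [/= -> ->]].
- by move=> B _; exact: measurable_atom.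
rewrite -fsbig_seq ?filter_uniq ?index_enum_uniq // big_filter -sumEFin.
apply: eq_bigr => B _; rewrite fineK // fin_num_measure //.
exact: measurable_atom.
Qed.

Lemma probability_superset (J : {set V}) :
  P [set w | J \subset A w] = (q ^+ #|J|)%:E.
Proof.
have [_ hP hI] := hA; have := hI J.
rewrite [X in P X = _](_ : _ = [set w | J \subset A w]); last first.
  apply/seteqP; split => w /= => [h|/fintype.subsetP h x]; last exact: h.
  by apply/fintype.subsetP => x xJ; exact: h.
by move=> ->; under eq_bigr do rewrite hP; rewrite prodEFin prodr_const.
Qed.

(** Independence gives the probabilities of the events [J \subset A w] only.
    These determine the law of [A], by downward induction on [B]: the supersets
    of [B] other than [B] itself are already known. *)
Lemma probability_atom (B : {set V}) :
  fine (P [set w | A w = B]) = binom_weight q B.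
Proof.
pose m B := fine (P [set w | A w = B]).
have key (J : {set V}) : \sum_(B : {set V} | J \subset B) m B =
             \sum_(B : {set V} | J \subset B) binom_weight q B.
  have /(congr1 fine) /= := probability_superset J.
  rewrite (probability_preimage (fun B => J \subset B)) /= => ->.
  rewrite -prob_subset /prob /expect [RHS]big_mkcond; apply: eq_bigr => C _.
  by case: (J \subset C); rewrite ?mulr1 ?mulr0.
move: {2}#|~: B|.+1 (ltnSn #|~: B|) => k; elim: k B => // k IH B Bk.
have := key B; rewrite (bigD1 B) //= [RHS](bigD1 B) //=.
rewrite (eq_bigr (binom_weight q)) => [/addIr //|C /andP[BC CB]].
apply: IH; rewrite -ltnS; apply: leq_trans Bk; rewrite ltnS; apply: proper_card.
by rewrite -finset.properC !finset.setCK finset.properEneq BC eq_sym CB.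
Qed.

(** This turns every probability of an event about [A] into a finite sum. *)
Lemma probability_binomial (Q : pred {set V}) :
  P [set w | Q (A w)] = (prob q Q)%:E.
Proof.
rewrite probability_preimage; congr _%:E.
rewrite /prob /expect big_mkcond; apply: eq_bigr => B _.
by rewrite probability_atom; case: (Q B); rewrite ?mulr1 ?mulr0.
Qed.

End Law.

(** A solution of [a + a = x] is determined by whether [a + a] wraps around. *)
Lemma card_halves_Zn n (x : 'Z_n) : (#|[set a : 'Z_n | (a + a == x)%R]%SET| <= 2)%N.
Proof.
set L := [set a | _]%SET; set N := (Zp_trunc n).+2.
pose wraps (a : 'Z_n) := (N <= a + a)%N.
rewrite -(card_in_imset (f := wraps)); last first.
  have val_x a : a \in L -> (a + a = x + wraps a * N)%N.
    rewrite inE => /eqP <- /=; rewrite -/N /wraps.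
    have := ltn_ord a; rewrite -/N => aN.
    case: (leqP N (a + a)) => aa; last by rewrite modn_small //= addn0.
    have e : (a + a = a + a - N + N)%N by rewrite subnK.
    by rewrite /= mul1n {2}e modnDr modn_small -?e // -(ltn_add2r N) -e -addnS leq_add // ltnW.
  by move=> a b /val_x ha /val_x hb ab; apply: val_inj => /=; rewrite ab in ha; lia.
by apply: leq_trans (max_card _) _; rewrite card_bool.
Qed.

(** * Limits *)

Lemma asymp_in_prob_finite (R : realType) (d : nat -> measure_display)
    (T : forall n, measurableType (d n)) (P : forall n, probability (T n) R)
    (p : nat -> R) (A : forall n, T n -> {set 'Z_n})
    (F : set_system nat) {FF : Filter F}
    (g : forall n, {set 'Z_n} -> nat) (f : nat -> R) :
  (forall n, 0 <= p n <= 1) ->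
  (forall n, (1 < n)%N -> binomial_random_subset (P n) (p n) (A n)) ->
  (\forall n \near F, (1 < n)%N) ->
  (forall eps dl, 0 < eps -> 0 < dl -> \forall n \near F,
    1 - dl <= prob (p n) (fun B : {set 'Z_n} =>
      (1 - eps) * f n < (g n B)%:R < (1 + eps) * f n)) ->
  asymp_in_prob P F (fun n w => (g n (A n w))%:R) f.
Proof.
move=> p01 hA hF hf eps eps0.
pose Q n (B : {set 'Z_n}) := (1 - eps) * f n < (g n B)%:R < (1 + eps) * f n.
have PQ n : (1 < n)%N ->
    P n [set w | (1 - eps) * f n < (g n (A n w))%:R < (1 + eps) * f n] =
    (prob (p n) (Q n))%:E.
  by move=> n1; exact: (probability_binomial (hA _ n1) (Q n)).
apply: cvg_EFin; first by apply: filterS hF => n /PQ ->.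
apply/cvgrPdist_le => /= dl dl0.
apply: filterS2 hF (hf _ _ eps0 dl0) => n n1 h.
rewrite /= PQ //= ger0_norm; last by rewrite subr_ge0 prob_le1.
by rewrite lerBlDr -lerBlDl.
Qed.

Lemma card_Zn n : (1 < n)%N -> #|'Z_n| = n.
Proof. by move=> n1; rewrite card_ord Zp_cast. Qed.

(** The common form of the moment bounds for the number of missing sums
    ([kappa = 1 / 2]) and of missing differences ([kappa = 1]): a target has
    about [kappa * n] representing pairs.  The numerical constants are those
    that differences require. *)
Definition missing_moments (R : realType) (kappa : R)
    (C : forall n, {set 'Z_n} -> {set 'Z_n}) : Prop :=
  forall n (q : R), (1 < n)%N -> 0 <= q <= 1 -> 32 * q ^+ 2 <= 1 ->
    expect q (fun B => #|~: C n B|%:R ^+ 2) <=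
      6 * n%:R + n%:R ^+ 2 *
        expR (- (2 * kappa * (n%:R - 2) * q ^+ 2) + 64 * q ^+ 3 * n%:R) /\
    (n%:R - 1) * (1 - q) ^+ 2 *
      expR (- (kappa * n%:R * (q ^+ 2 / (1 - q ^+ 2)))) <=
      expect q (fun B => #|~: C n B|%:R).

Lemma sqr_small_lt1 (R : realType) (q : R) :
  0 <= q <= 1 -> 32 * q ^+ 2 <= 1 -> 0 <= q < 1.
Proof. by move=> /andP[q0 q1] h; rewrite q0 /=; nra. Qed.

Lemma sumset_missing_moments (R : realType) :
  missing_moments (2^-1 : R) (fun n B => sumset B B).
Proof.
move=> n q n1 q01 hq; split.
  have := sum_missing_second_moment (@card_halves_Zn n) q01 hq.
  by rewrite card_Zn // divff ?mul1r.
have := sum_missing_first_moment (@card_halves_Zn n) (sqr_small_lt1 q01 hq).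
by rewrite card_Zn.
Qed.

Lemma diffset_missing_moments (R : realType) :
  missing_moments (1 : R) (fun n B => diffset B B).
Proof.
move=> n q n1 q01 hq; split.
  have := diff_missing_second_moment (@card_halves_Zn n) q01 hq.
  by rewrite card_Zn // mulr1.
have := diff_missing_first_moment 'Z_n (sqr_small_lt1 q01 hq).
by rewrite card_Zn // mul1r.
Qed.

(** If the proportion of missing elements has mean [mu] in the limit and no
    variance, then [C n] has about [n * (1 - mu)] elements. *)
Lemma asymp_of_missing_moments (R : realType) (d : nat -> measure_display)
    (T : forall n, measurableType (d n)) (P : forall n, probability (T n) R)
    (p : nat -> R) (A : forall n, T n -> {set 'Z_n})
    (F : set_system nat) {FF : Filter F}
    (C : forall n, {set 'Z_n} -> {set 'Z_n}) (mu : R) :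
  (forall n, 0 <= p n <= 1) ->
  (forall n, (1 < n)%N -> binomial_random_subset (P n) (p n) (A n)) ->
  (\forall n \near F, (1 < n)%N) ->
  0 <= mu < 1 ->
  (forall eta, 0 < eta -> \forall n \near F,
    expect (p n) (fun B => #|~: C n B|%:R ^+ 2) <= n%:R ^+ 2 * (mu ^+ 2 + eta)) ->
  (forall eta, 0 < eta -> \forall n \near F,
    n%:R * (mu - eta) <= expect (p n) (fun B => #|~: C n B|%:R)) ->
  asymp_in_prob P F (fun n w => #|C n (A n w)|%:R) (fun n => n%:R * (1 - mu)).
Proof.
move=> p01 hA hF /andP[mu0 mu1] h2 h1.
apply: (asymp_in_prob_finite (g := fun n B => #|C n B|)) => // eps dl e0 dl0.
pose t := eps * (1 - mu); have t0 : 0 < t by rewrite mulr_gt0 // subr_gt0.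
pose eta := dl * t ^+ 2 / 3.
have eta0 : 0 < eta by rewrite divr_gt0 // mulr_gt0 // exprn_gt0.
near=> n.
have n1 : (1 < n)%N by near: n.
have n0 : (0 : R) < #|'Z_n|%:R by rewrite card_Zn // ltr0n ltnW.
have -> : dl = 3 * eta / t ^+ 2.
  by rewrite /eta; field; rewrite gt_eqF.
apply: (le_trans (prob_near_mean (M := fun B => #|~: C n B|%:R) (mu := mu)
  (p01 n) n0 t0 _ (ltW eta0) _ _)); rewrite ?card_Zn //.
- by rewrite mu0 ltW.
- by near: n; exact: h2.
- by near: n; exact: h1.
apply: prob_le => // B; rewrite ltr_norml => /andP[lo hi].
have cC : #|C n B|%:R + #|~: C n B|%:R = n%:R :> R.
  by rewrite -natrD cardsC card_Zn.
rewrite /t in lo hi; apply/andP; split; lra.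
Unshelve. all: by end_near. Qed.

Section Limits.
Variables (R : realType) (d : nat -> measure_display).
Variables (T : forall n, measurableType (d n)) (P : forall n, probability (T n) R).
Variables (p : nat -> R) (A : forall n, T n -> {set 'Z_n}).
Hypothesis p01 : forall n, 0 <= p n <= 1.
Hypothesis hA :
  forall n, (1 < n)%N -> binomial_random_subset (P n) (p n) (@A n).
Hypothesis p_cvg0 : p n @[n --> \oo] --> 0.

Lemma p_eventually_le (eta : R) : 0 < eta -> \forall n \near \oo, p n <= eta.
Proof.
move=> eta0; move/cvgrPdist_le : p_cvg0 => /(_ _ eta0); apply: filterS => n.
by rewrite sub0r normrN ger0_norm //; case/andP: (p01 n).
Qed.

(** With [n * p n ^+ 2 = c ^+ 2], both moment bounds become continuous functions
    of [p n] alone, so their limits are their values at [0]. *)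
Lemma critical_regime (kappa c : R) (C : forall n, {set 'Z_n} -> {set 'Z_n}) :
  missing_moments kappa C -> 0 < kappa -> 0 < c ->
  (\forall n \near \oo, p n = c * (Num.sqrt n%:R)^-1) ->
  asymp_in_prob P \oo (fun n w => #|C n (@A n w)|%:R)
    (fun n => n%:R * (1 - expR (- (kappa * c ^+ 2)))).
Proof.
move=> hC k0 c0 hp.
have p2_cvg0 : p n ^+ 2 @[n --> \oo] --> (0 : R).
  have h : p n * p n @[n --> \oo] --> (0 * 0 : R) by exact: cvgM.
  by under eq_fun do rewrite expr2; rewrite mul0r in h.
have expR_cvg (f : nat -> R) (l : R) :
    f n @[n --> \oo] --> l -> expR (f n) @[n --> \oo] --> expR l.
  by move=> h; apply: (continuous_cvg _ _ h); exact: continuous_expR.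
have np2 : \forall n \near \oo, [/\ (1 < n)%N, n%:R * p n ^+ 2 = c ^+ 2,
    n%:R != 0 :> R, p n != 0 & 32 * p n ^+ 2 <= 1].
  near=> n; have n1 : (1 < n)%N by near: n; exact: nbhs_infty_gt.
  have nn0 : n%:R != 0 :> R by rewrite pnatr_eq0; lia.
  have np : n%:R * p n ^+ 2 = c ^+ 2.
    rewrite (near hp n) // exprMn exprVn sqr_sqrtr //.
    by rewrite mulrCA divff ?mulr1.
  split=> //.
    apply: contraTneq c0 => pn; move: np; rewrite pn expr0n mulr0 => /esym/eqP.
    by rewrite sqrf_eq0 => /eqP ->; rewrite ltxx.
  have ps : p n <= 1 / 32 by near: n; exact: p_eventually_le.
  by have /andP[? ?] := p01 n; nra.
apply: (asymp_of_missing_moments (C := C)) => //.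
- by rewrite expR_ge0 expR_lt1 oppr_lt0 mulr_gt0 ?exprn_gt0.
- move=> eta eta0.
  have lim2 : 6 * p n ^+ 2 / c ^+ 2 + expR (- (2 * kappa * c ^+ 2)
      + 4 * kappa * p n ^+ 2 + 64 * c ^+ 2 * p n) @[n --> \oo] -->
    expR (- (kappa * c ^+ 2)) ^+ 2.
    have -> : expR (- (kappa * c ^+ 2)) ^+ 2 = 6 * 0 / c ^+ 2 + expR (- (2 * kappa * c ^+ 2)
        + 4 * kappa * 0 + 64 * c ^+ 2 * 0).
      by rewrite !mulr0 mul0r !addr0 add0r -expRM_natl; congr expR; ring.
    apply: cvgD; first exact: (cvgM (cvgM (cvg_cst _) p2_cvg0) (cvg_cst _)).
    apply: expR_cvg.
    apply: cvgD; last exact: (cvgM (cvg_cst _) p_cvg0).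
    by apply: cvgD; [exact: cvg_cst | exact: (cvgM (cvg_cst _) p2_cvg0)].
  move/cvgrPdist_le : lim2 => /(_ _ eta0) lim2.
  near=> n; have [n1 np nn0 pn0 hsmall] : [/\ (1 < n)%N, n%:R * p n ^+ 2 = c ^+ 2,
      n%:R != 0 :> R, p n != 0 & 32 * p n ^+ 2 <= 1] by near: n.
  have [h _] := hC n (p n) n1 (p01 n) hsmall.
  apply: (le_trans h).
  have : `|expR (- (kappa * c ^+ 2)) ^+ 2 - (6 * p n ^+ 2 / c ^+ 2 +
     expR (- (2 * kappa * c ^+ 2) + 4 * kappa * p n ^+ 2 + 64 * c ^+ 2 * p n))|
     <= eta by near: n.
  rewrite ler_norml => /andP[lo _].
  (* 1 / n = p n ^+ 2 / c ^+ 2 removes n from the bound *)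
  have -> : 6 * n%:R = n%:R ^+ 2 * (6 * p n ^+ 2 / c ^+ 2).
    by rewrite -np; field; rewrite pn0 nn0.
  rewrite -mulrDr ler_wpM2l ?sqr_ge0 //.
  have -> : - (2 * kappa * (n%:R - 2) * p n ^+ 2) + 64 * p n ^+ 3 * n%:R =
     - (2 * kappa * c ^+ 2) + 4 * kappa * p n ^+ 2 + 64 * c ^+ 2 * p n.
    by rewrite -np; ring.
  lra.
- move=> eta eta0.
  have lim1 : (1 - p n ^+ 2 / c ^+ 2) * (1 - p n) ^+ 2 *
      expR (- (kappa * c ^+ 2 / (1 - p n ^+ 2))) @[n --> \oo] -->
    expR (- (kappa * c ^+ 2)).
    have -> : expR (- (kappa * c ^+ 2)) = (1 - 0 / c ^+ 2) * (1 - 0) ^+ 2 *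
      expR (- (kappa * c ^+ 2 / (1 - 0))).
      by rewrite mul0r !subr0 expr1n !mul1r divr1.
    have q_cvg1 : 1 - p n ^+ 2 @[n --> \oo] --> (1 - 0 : R).
      exact: (cvgB (cvg_cst _) p2_cvg0).
    apply: cvgM.
      apply: cvgM; first exact: (cvgB (cvg_cst _) (cvgM p2_cvg0 (cvg_cst _))).
      have h : 1 - p n @[n --> \oo] --> (1 - 0 : R) by exact: (cvgB (cvg_cst _)).
      by under eq_fun do rewrite expr2; exact: (cvgM h h).
    apply: expR_cvg.
    apply: cvgN; apply: cvgM; first exact: cvg_cst.
    by apply: cvgV => //; rewrite subr0 oner_neq0.
  move/cvgrPdist_le : lim1 => /(_ _ eta0) lim1.
  near=> n; have [n1 np nn0 pn0 hsmall] : [/\ (1 < n)%N, n%:R * p n ^+ 2 = c ^+ 2,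
      n%:R != 0 :> R, p n != 0 & 32 * p n ^+ 2 <= 1] by near: n.
  have [_ h] := hC n (p n) n1 (p01 n) hsmall.
  apply: le_trans h.
  have : `|expR (- (kappa * c ^+ 2)) - (1 - p n ^+ 2 / c ^+ 2) * (1 - p n) ^+ 2 *
      expR (- (kappa * c ^+ 2 / (1 - p n ^+ 2)))| <= eta by near: n.
  rewrite ler_norml => /andP[_ hi].
  have -> : n%:R - 1 = n%:R * (1 - p n ^+ 2 / c ^+ 2).
    by rewrite -np; field; rewrite pn0 nn0.
  rewrite -!(mulrA n%:R) ler_wpM2l //.
  have -> : kappa * n%:R * (p n ^+ 2 / (1 - p n ^+ 2)) =
            kappa * c ^+ 2 / (1 - p n ^+ 2) by rewrite -np; ring.
  lra.
Unshelve. all: by end_near. Qed.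

(** When [n * p n ^+ 2] tends to infinity, even the second moment of the
    proportion of missing elements tends to [0]. *)
Lemma slow_regime (kappa : R) (C : forall n, {set 'Z_n} -> {set 'Z_n})
    (F : set_system nat) {FF : Filter F} :
  missing_moments kappa C -> 0 < kappa -> F --> \oo ->
  (forall K : R, \forall n \near F, K <= n%:R * p n ^+ 2) ->
  asymp_in_prob P F (fun n w => #|C n (@A n w)|%:R) (fun n => n%:R).
Proof.
move=> hC k0 Foo hnp.
have p_small (eta : R) : 0 < eta -> \forall n \near F, p n <= eta.
  by move=> eta0; apply: Foo; exact: p_eventually_le.
have n_gt1 : \forall n \near F, (1 < n)%N by apply: Foo; exact: nbhs_infty_gt.
rewrite (_ : (fun n => n%:R) = (fun n => n%:R * (1 - 0 : R))); last first.
  by apply/funext => n; rewrite subr0 mulr1.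
apply: (asymp_of_missing_moments (C := C)) => //.
- by rewrite lexx ltr01.
- move=> eta eta0; near=> n.
  have n1 : (1 < n)%N by near: n.
  have n0 : (0 : R) < n%:R by rewrite ltr0n ltnW.
  have /andP[p0 p1] := p01 n.
  have p32 : p n <= 1 / 32 by near: n; exact: p_small.
  have hsmall : 32 * p n ^+ 2 <= 1 by nra.
  have pk : p n <= kappa / 64 by near: n; apply: p_small; rewrite divr_gt0.
  (* K1 makes 6 / n at most eta / 2, and K2 does so for the exponential *)
  have K1 : 12 / eta <= n%:R * p n ^+ 2 by near: n.
  have K2 : (4 * kappa + 2 / eta) / kappa <= n%:R * p n ^+ 2 by near: n.
  have [h _] := hC n (p n) n1 (p01 n) hsmall; apply: (le_trans h).
  have pp1 : p n ^+ 2 <= 1 by rewrite expr_le1.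
  have hn : 6 * n%:R <= n%:R ^+ 2 * (eta / 2).
    have : 12 <= n%:R * eta.
      rewrite -ler_pdivrMr //; apply: (le_trans K1).
      by rewrite ler_piMr // ltW.
    by move=> h12; have := ler_wpM2l (ltW n0) h12; lra.
  have hexp : expR (- (2 * kappa * (n%:R - 2) * p n ^+ 2) + 64 * p n ^+ 3 * n%:R)
      <= eta / 2.
    apply: (@le_trans _ _ (expR (- (2 / eta)))).
      rewrite ler_expR; move: K2; rewrite ler_pdivrMr // => K2.
      have np0 : 0 <= n%:R * p n ^+ 2 by rewrite mulr_ge0 ?sqr_ge0.
      have := ler_wpM2r np0 pk.
      have := ler_wpM2l (ltW k0) pp1.
      lra.
    rewrite expRN -[leRHS]invrK lef_pV2 ?posrE ?invr_gt0 ?divr_gt0 ?expR_gt0 //.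
    by rewrite invf_div; apply: le_trans (expR_ge1Dx _); rewrite lerDr.
  rewrite expr0n add0r.
  have := ler_wpM2l (sqr_ge0 (n%:R : R)) hexp; lra.
- move=> eta eta0; apply: filterE => n.
  apply: (@le_trans _ _ 0).
    by rewrite sub0r mulrN oppr_le0 mulr_ge0 // ltW.
  rewrite -[leLHS](expect_cst 'Z_n (p n)); exact: expect_le.
Unshelve. all: by end_near. Qed.

(** When [n * p n] is large and [n * p n ^+ 2] small, the cardinal of the random
    set is close to [n * p n] and collisions are rare, so any cardinal that
    these two quantities control has the expected size. *)
Lemma fast_regime (k : R) (g : forall n, {set 'Z_n} -> nat) :
  0 <= k ->
  (forall n (delta : R) (B : {set 'Z_n}), (1 < n)%N ->
    0 < delta <= 1 -> 1 <= delta * (#|'Z_n|%:R * p n) ->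
    `|#|B|%:R - #|'Z_n|%:R * p n| < delta * (#|'Z_n|%:R * p n) ->
    collisions R B < delta * (#|'Z_n|%:R * p n) ^+ 2 ->
    (1 - 6 * delta) * (k * (#|'Z_n|%:R * p n) ^+ 2) < (g n B)%:R <
    (1 + 6 * delta) * (k * (#|'Z_n|%:R * p n) ^+ 2)) ->
  (forall eta : R, 0 < eta -> \forall n \near \oo, 1 <= eta * (n%:R * p n)) ->
  (forall eta : R, 0 < eta -> \forall n \near \oo, n%:R * p n ^+ 2 <= eta) ->
  asymp_in_prob P \oo (fun n w => (g n (@A n w))%:R)
    (fun n => k * (n%:R * p n) ^+ 2).
Proof.
move=> k0 window hnp hnp2.
apply: (asymp_in_prob_finite (g := g)) => // eps dl e0 dl0.
pose delta := Num.min 1 eps / 6.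
have d0 : 0 < delta by rewrite divr_gt0 // lt_min ltr01.
have [d1 de] : Num.min 1 eps <= 1 /\ Num.min 1 eps <= eps.
  by split; rewrite ge_min lexx ?orbT.
have d01 : 0 < delta <= 1 by rewrite d0 /delta; lra.
pose eta := delta ^+ 2 * dl / 6.
have eta0 : 0 < eta by rewrite divr_gt0 // mulr_gt0 // exprn_gt0.
near=> n.
have n1 : (1 < n)%N by near: n; exact: nbhs_infty_gt.
have hN : 1 <= eta * (n%:R * p n) by near: n; exact: hnp.
have hN' : 1 <= delta * (n%:R * p n) by near: n; exact: hnp.
have h2 : n%:R * p n ^+ 2 <= eta by near: n; exact: hnp2.
have h3 : p n <= eta by near: n; exact: p_eventually_le.
rewrite -{1}(card_Zn n1) in hN; rewrite -{1}(card_Zn n1) in hN'; rewrite -{1}(card_Zn n1) in h2.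
have := fast_concentration (p01 n) (@card_halves_Zn n) d01 eta0 hN h2 h3
  (fun B => window n delta B n1 d01 hN').
have -> : 6 * eta / delta ^+ 2 = dl by rewrite /eta; field; rewrite gt_eqF.
move=> h; apply: (le_trans h); apply: prob_le => // B.
rewrite card_Zn //; set m := k * _ => /andP[lo hi].
have m0 : 0 <= m by rewrite mulr_ge0 ?sqr_ge0.
have md : 6 * delta * m <= eps * m by rewrite ler_wpM2r // /delta; lra.
by apply/andP; split; lra.
Unshelve. all: by end_near. Qed.

End Limits.

Lemma littleo_cst_cvg0 (R : realType) (p : nat -> R) :
  p =o_\oo (fun=> 1 : R) -> p n @[n --> \oo] --> 0.
Proof.
move=> /eqoP hp; apply/cvgrPdist_le => eta eta0; apply: filterS (hp _ eta0) => n.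
by rewrite sub0r normrN normr1 mulr1.
Qed.

Unset Implicit Arguments.

Theorem theorem1p1 (R : realType) (d : nat -> measure_display)
    (T : forall n, measurableType (d n)) (P : forall n, probability (T n) R)
    (p : nat -> R) (A : forall n, T n -> {set 'Z_n}) :
  (forall n, 0 <= p n <= 1) ->
  p =o_\oo (fun=> 1 : R) ->
  (forall n, (1 < n)%N -> binomial_random_subset (P n) (p n) (A n)) ->
  let S n (w : T n) : R := #|sumset (A n w) (A n w)|%:R in
  let D n (w : T n) : R := #|diffset (A n w) (A n w)|%:R in
  [/\ (fun n => (n%:R^-1)%R : R) =o_\oo p ->
      p =o_\oo (fun n => ((Num.sqrt n%:R)^-1)%R : R) ->
      asymp_in_prob P \oo S (fun n => 2^-1 * (n%:R * p n) ^+ 2) /\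
      asymp_in_prob P \oo D (fun n => (n%:R * p n) ^+ 2),
      forall c : R, 0 < c ->
      (\forall n \near \oo, p n = c * (Num.sqrt n%:R)^-1) ->
      asymp_in_prob P \oo S (fun n => n%:R * (1 - expR (- (c ^+ 2 / 2)))) /\
      asymp_in_prob P \oo D (fun n => n%:R * (1 - expR (- c ^+ 2)))
    & (fun n => (Num.sqrt (ln n%:R) * (Num.sqrt n%:R)^-1)%R : R)
        =o_prime_oo p ->
      asymp_in_prob P prime_oo S (fun n => n%:R) /\
      asymp_in_prob P prime_oo D (fun n => n%:R)].
Proof.
move=> p01 /littleo_cst_cvg0 p_cvg0 hA S D.
have half0 : (0 : R) < 2^-1 by rewrite invr_gt0.
have sumM := @sumset_missing_moments R.
have diffM := @diffset_missing_moments R.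
split.
- move=> /eqoP hinv /eqoP hsqrt.
  have hnp (eta : R) : 0 < eta -> \forall n \near \oo, 1 <= eta * (n%:R * p n).
    move=> eta0; apply: filterS2 (nbhs_infty_gt 0) (hinv _ eta0) => n n0.
    have /andP[pn0 _] := p01 n; rewrite !ger0_norm ?invr_ge0 // => h.
    have n0' : 0 < n%:R :> R by rewrite ltr0n.
    by have := ler_wpM2l (ltW n0') h; rewrite divff ?gt_eqF // mulrCA.
  have hnp2 (eta : R) : 0 < eta -> \forall n \near \oo, n%:R * p n ^+ 2 <= eta.
    move=> eta0; have s0 : 0 < Num.sqrt eta by rewrite sqrtr_gt0.
    apply: filterS2 (nbhs_infty_gt 0) (hsqrt _ s0) => n n0.
    have /andP[pn0 _] := p01 n; rewrite !ger0_norm ?invr_ge0 ?sqrtr_ge0 // => h.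
    have n0' : 0 < n%:R :> R by rewrite ltr0n.
    have : p n ^+ 2 <= (Num.sqrt eta / Num.sqrt n%:R) ^+ 2.
      by rewrite lerXn2r ?nnegrE ?divr_ge0 ?sqrtr_ge0.
    rewrite exprMn exprVn !sqr_sqrtr ?(ltW eta0) // => h2.
    by rewrite mulrC -ler_pdivlMr.
  split.
    apply: (fast_regime p01 hA p_cvg0 (g := fun n B => #|sumset B B|)) => //.
    by move=> n delta B _; exact: card_sumset_window.
  rewrite (_ : (fun n => _) = (fun n => 1 * (n%:R * p n) ^+ 2)); last first.
    by apply/funext => n; rewrite mul1r.
  apply: (fast_regime p01 hA p_cvg0 (g := fun n B => #|diffset B B|)) => //.
  by move=> n delta B _ d01 h1 h2 h3; rewrite mul1r; exact: card_diffset_window.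
- move=> c c0 hp; split.
    rewrite (_ : c ^+ 2 / 2 = 2^-1 * c ^+ 2); last by rewrite mulrC.
    exact: (critical_regime p01 hA p_cvg0 sumM).
  rewrite -(mul1r (c ^+ 2)).
  exact: (critical_regime p01 hA p_cvg0 diffM).
- move=> /eqoP hlog.
  have Foo : prime_oo --> \oo by move=> Q; apply: filterS => n Qn _.
  have hnp2 (K : R) : \forall n \near prime_oo, K <= n%:R * p n ^+ 2.
    pose K' := Num.max 1 K.
    have K1 : 1 <= K' by rewrite le_max lexx.
    have K'0 : 0 < K' by lra.
    have K0 : 0 < K'^-1 by rewrite invr_gt0.
    have big : \forall n \near prime_oo, expR 1 <= n%:R :> R.
      by apply: Foo; exact: nbhs_infty_ger.
    apply: filterS2 big (hlog _ K0) => n ne.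
    have n0 : 0 < n%:R :> R by apply: lt_le_trans ne; exact: expR_gt0.
    have ln1 : 1 <= ln (n%:R : R) by rewrite -[leLHS]expRK ler_ln ?posrE ?expR_gt0.
    have /andP[pn0 _] := p01 n.
    rewrite !ger0_norm ?mulr_ge0 ?invr_ge0 ?sqrtr_ge0 // => h.
    have : (Num.sqrt (ln n%:R) / Num.sqrt n%:R) ^+ 2 <= (K'^-1 * p n) ^+ 2.
      by rewrite lerXn2r ?nnegrE ?divr_ge0 ?mulr_ge0 ?sqrtr_ge0 // ltW.
    rewrite !exprMn !exprVn !sqr_sqrtr ?(ltW n0) ?(le_trans ler01 ln1) //.
    move=> h2; apply: (@le_trans _ _ (K' ^+ 2)).
      apply: (@le_trans _ _ K'); first by rewrite le_max lexx orbT.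
      by rewrite expr2 ler_peMl //; lra.
    have K20 : 0 < K' ^+ 2 by rewrite exprn_gt0 //; lra.
    have := ler_wpM2l (ltW (mulr_gt0 K20 n0)) h2.
    have [nK' nn] : K' != 0 /\ n%:R != 0 :> R by rewrite !gt_eqF.
    rewrite [X in _ <= X -> _](_ : _ = n%:R * p n ^+ 2); last by field.
    apply: le_trans.
    rewrite [leRHS](_ : _ = K' ^+ 2 * ln n%:R); last by field.
    by rewrite ler_peMr // ltW.
  split.
    exact: (slow_regime p01 hA p_cvg0 sumM).
  exact: (slow_regime p01 hA p_cvg0 diffM).
Qed.
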